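(* Assume $\Diamond$. Then there exists an infinite $h$-homogeneous Fedorchuk space; that is, there is an infinite zero-dimensional compact Hausdorff, hereditarily separable space $X$ with no non-trivial convergent sequences such that any two non-empty clopen subsets of $X$ are homeomorphic to each other.
   Context: $\Diamond$ is Jensen's diamond principle: there is a sequence $\langle A_\alpha:\alpha<\omega_1\rangle$ with $A_\alpha\subseteq\alpha$ such that for every $A\subseteq\omega_1$ the set $\{\alpha<\omega_1:A\cap\alpha=A_\alpha\}$ is stationary in $\omega_1$. A space is hereditarily separable if every subspace is separable. A convergent sequence is non-trivial if it is not eventually constant. A Fedorchuk space is a compact (Hausdorff), hereditarily separable space with no non-trivial convergent sequences. A space is zero-dimensional if it has a base of clopen sets. A zero-dimensional space is $h$-homogeneous if any two of its non-empty clopen subsets are homeomorphic to each other. *)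

(* Defs.v *)
From HB Require Import structures.
From mathcomp Require Import all_boot all_order.
From mathcomp Require Import all_classical wochoice.
From mathcomp Require Import topology.

Set Implicit Arguments.
Unset Strict Implicit.
Unset Printing Implicit Defensive.

Local Open Scope classical_set_scope.

Section Omega1.
Context {d : Order.disp_t} (W : orderType d).
Implicit Types (a b c : W) (C S : set W).

(* [W] has order type omega_1: it is an uncountable well-order all of whose
   proper initial segments are countable. *)
Definition is_omega1 : Prop :=
  [/\ well_order (<=%O : rel W),
      ~ countable [set: W] &
      forall a, countable [set b | (b < a)%O]].

Definition unbounded C : Prop := forall a, exists2 c, C c & (a < c)%O.

(* An [a] in which [C] is strictly cofinal and which is not the least element
   is automatically a limit. *)
Definition closed_below_limits C : Prop :=
  forall a, (exists b, (b < a)%O) ->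
    (forall b, (b < a)%O -> exists2 c, C c & (b < c < a)%O) -> C a.

Definition club C : Prop := closed_below_limits C /\ unbounded C.

Definition stationary S : Prop := forall C, club C -> S `&` C !=set0.

(* Ordinals are identified with their sets of predecessors. *)
Definition diamond : Prop :=
  exists2 D : W -> set W,
    forall a, D a `<=` [set b | (b < a)%O] &
    forall A : set W, stationary [set a | A `&` [set b | (b < a)%O] = D a].

End Omega1.

Definition separable (T : topologicalType) : Prop :=
  exists2 D : set T, countable D & dense D.

(* A set [A] used as a type carries the subspace topology. *)
Definition hereditarily_separable (X : topologicalType) : Prop :=
  forall A : set X, separable A.

Definition no_nontrivial_convergent_sequence (X : topologicalType) : Prop :=
  forall (u : nat -> X) (x : X), u @ \oo --> x ->
    exists c : X, \forall n \near \oo, u n = c.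

Definition fedorchuk_space (X : topologicalType) : Prop :=
  [/\ compact [set: X], hausdorff_space X, hereditarily_separable X &
      no_nontrivial_convergent_sequence X].

(* The library's [zero_dimensional] only asks that clopen sets separate
   points. *)
Definition has_clopen_base (X : topologicalType) : Prop :=
  exists2 B : set (set X), B `<=` clopen & basis B.

Definition homeomorphic (S T : topologicalType) : Prop :=
  exists (f : S -> T) (g : T -> S),
    [/\ continuous f, continuous g, cancel f g & cancel g f].

Definition h_homogeneous (X : topologicalType) : Prop :=
  has_clopen_base X /\
  forall U V : set X, clopen U -> clopen V -> U !=set0 -> V !=set0 ->
    homeomorphic U V.

(* Main.v *)
From HB Require Import structures.
Require Import Defs.
From mathcomp Require Import all_boot all_order.
From mathcomp Require Import all_classical wochoice.
From mathcomp Require Import topology.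

(* The space is the limit of an inverse system of Cantor sets [X_c], [c] below
   omega_1.  Each [X_c] carries a countable group of homeomorphisms that acts
   freely, and the system is equivariant.  At stage [c] a generic homeomorphism
   is added to the group, keeping the action free and, if bookkeeping demands
   it, mapping one given proper clopen set onto another; this yields
   h-homogeneity.  Then one orbit is split: each of its points [w x] is replaced
   by two points, the two sides being given by a clopen partition of [X_c]
   minus [x] moved by [w].  By freeness this is consistent.
   Diamond guesses at stage [c] the projection [F_c] of a set of points, and
   [x] is taken to be an accumulation point of [F_c] when there is one.  All the
   later splittings keep the promise that near each point lying over an
   accumulation point of [F_c] there are whole fibres over points of [F_c]:
   the two sides of a split point are chosen to contain infinitely many
   members of each of countably many sequences of fibres converging to it.
   Guessing the range of a sequence shows that it does not converge, as its
   limit is split; guessing a left-separated omega_1-sequence contradicts left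
   separation, because [p c] is a limit of the earlier points. *)

Set Implicit Arguments.
Unset Strict Implicit.
Unset Printing Implicit Defensive.
Import Order.TTheory.

(** * The Cantor set *)

(** A homeomorphism of [X_c] survives to the limit only if every later splitting respects it. This
    is why a whole orbit is split, and why the group must act freely: an element fixing [x] without
    being the identity could exchange the two sides of [x]. The split function is recorded along the
    orbit, with a coordinate for each word [w] holding the value at [w^-1 z]; lifting the action is
    then a mere shift of coordinates, and freeness passes upwards. The new generator comes from a
    category argument in the homeomorphism group of the Cantor set: for each reduced word, having no
    fixed points is an open dense condition, density being proved by induction on the length of the
    word. This requires every [X_c] to be a Cantor set again, hence perfect. Perfectness comes from
    the same promise: the set of all points of the initial Cantor set is treated as one more guess,
    at which every point accumulates. *)

Definition agree n (x y : nat -> bool) := forall i, i < n -> x i = y i.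

Lemma agree_sym n x y : agree n x y -> agree n y x.
Proof. by move=> h i /h. Qed.

Lemma agree_trans n y x z : agree n x y -> agree n y z -> agree n x z.
Proof. by move=> h k i hi; rewrite h ?k. Qed.

Lemma agree_le m n x y : m <= n -> agree n x y -> agree m x y.
Proof. by move=> mn h i hi; apply: h; apply: leq_trans mn. Qed.

Lemma agree_eq x y : (forall n, agree n x y) -> x = y.
Proof. by move=> h; apply: funext => i; apply: (h i.+1). Qed.

Lemma neq_agree x y : x <> y -> exists n, ~ agree n x y.
Proof. by move=> nxy; apply/existsNP => h; apply: nxy; apply: agree_eq. Qed.

(** Compactness of the Cantor set: if no [N] worked, a bad finite sequence could be prolonged bit by
    bit forever, against the assumption at the limit branch. *)
Lemma fan (P : nat -> (nat -> bool) -> Prop) :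
  (forall m n y, m <= n -> P m y -> P n y) ->
  (forall x, exists n, forall y, agree n x y -> P n y) ->
  exists N, forall y, P N y.
Proof.
move=> Pmono Pbar; apply: contrapT => /forallNP hN.
pose bad n x := forall N, exists2 y, agree n x y & ~ P N y.
pose set x n (b : bool) := fun i : nat => if i == n then b else x i.
have ext n x : bad n x -> exists b, bad n.+1 (set x n b).
  move=> bx; apply: contrapT => /forallNP h.
  have {}h b : exists N, forall y, agree n.+1 (set x n b) y -> P N y.
    have /existsNP[N hN'] := h b; exists N => y a; apply: contrapT => nP.
    by apply: hN'; exists y.
  have [N0 h0] := h false; have [N1 h1] := h true.
  have [y axy] := bx (maxn N0 N1); apply.
  have ay : agree n.+1 (set x n (y n)) y.
    move=> i; rewrite ltnS leq_eqVlt /set; case: eqP => [->//|_] /= /axy //.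
  by case: (y n) ay => [/h1|/h0]; apply: Pmono; rewrite ?leq_maxl ?leq_maxr.
have /choice[f hf] (p : nat * (nat -> bool)) :
    exists b, bad p.1 p.2 -> bad p.1.+1 (set p.2 p.1 b).
  have [/ext[b hb]|h] := pselect (bad p.1 p.2); first by exists b.
  by exists true.
pose fix s n := if n is m.+1 then set (s m) m (f (m, s m)) else fun=> true.
have bs n : bad n (s n).
  elim: n => [|n IH] /=; last exact: (hf (n, s n)).
  move=> N; apply: contrapT => h; apply: (hN N) => y.
  by apply: contrapT => nP; apply: h; exists y.
pose x i := s i.+1 i.
have ax n : agree n x (s n).
  move=> i; elim: n => // n IH; rewrite ltnS leq_eqVlt => /predU1P[->//|lin].
  by rewrite IH //= /set (ltn_eqF lin).
have [n hn] := Pbar x; have [y ay] := bs n n; apply; apply: hn.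
exact: agree_trans ay.
Qed.

Definition cont (f : (nat -> bool) -> nat -> bool) :=
  forall x k, exists n, forall y, agree n x y -> agree k (f x) (f y).

Lemma cont_unif f k : cont f ->
  exists n, forall x y, agree n x y -> agree k (f x) (f y).
Proof.
move=> cf; have [|x|N hN] :=
  fan (P := fun n x => forall y, agree n x y -> agree k (f x) (f y)).
- by move=> m n x mn h y a; apply: h; apply: agree_le a.
- have [n hn] := cf x k; exists n => y a z a'.
  by apply: (agree_trans (y := f x)); [exact/agree_sym/hn|apply/hn/(agree_trans a)].
- by exists N => x y; apply: hN.
Qed.

Lemma cont_comp f g : cont f -> cont g -> cont (f \o g).
Proof.
move=> cf cg x k; have [n hn] := cf (g x) k; have [m hm] := cg x n.
by exists m => y /hm /hn.
Qed.

Lemma cont_id : cont id. Proof. by move=> x k; exists k. Qed.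

(** * Brouwer's characterisation of the Cantor set *)

Section Brouwer.
Variable P : (nat -> bool) -> Prop.
Hypothesis Pclosed : forall x, (forall n, exists2 y, P y & agree n x y) -> P x.
Hypothesis Pperf : forall x n, P x -> exists y, [/\ P y, agree n x y & y <> x].
Hypothesis Pne : exists x, P x.

Implicit Types A : set (nat -> bool).

Definition varying A k := exists x y, [/\ A x, A y & x k <> y k].

Definition nx A : nat :=
  if pselect (exists k, `[< varying A k >]) is left h then ex_minn h else 0.

(** The modulus [m] is uniform in [x], so [A] is relatively clopen in [P], and closed as [P] is. *)
Definition good A := [/\ A `<=` P, A !=set0 &
  exists m, forall x y, A x -> P y -> agree m x y -> A y]%classic.

Lemma nxP A : good A ->
  varying A (nx A) /\ forall k x y, k < nx A -> A x -> A y -> x k = y k.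
Proof.
move=> [AP [x Ax] [m hm]].
have ex : exists k, `[< varying A k >].
  have [y [Py axy nyx]] := Pperf m (AP _ Ax).
  have [n hn] := neq_agree nyx.
  have /existsNP[k /not_implyP[kn yk]] := hn.
  by exists k; apply/asboolP; exists y, x; split=> //; apply: hm axy.
rewrite /nx; case: pselect => // h; case: ex_minnP => nx0 /asboolP vk mink.
split=> // j u v jk Au Av; apply: contrapT => nuv.
suff : nx0 <= j by rewrite leqNgt jk.
by apply: mink; apply/asboolP; exists u, v.
Qed.

Definition cut A (b : bool) : set (nat -> bool) := fun x => A x /\ x (nx A) = b.

Lemma cut_good A b : good A -> good (cut A b).
Proof.
move=> gA; have [[x [y [Ax Ay nxy]]] _] := nxP gA; case: (gA) => AP _ [m hm].
split; first by move=> z [/AP].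
- have [xb|/eqP xb] := eqVneq (x (nx A)) b; first by exists x.
  by exists y; split=> //; move: nxy xb; case: (x _); case: (y _); case: b.
- exists (maxn m (nx A).+1) => u v [Au ub] Pv a; split.
    by apply: hm Au Pv _; apply: agree_le a; apply: leq_maxl.
  by rewrite -a ?leq_maxr.
Qed.

Fixpoint cell (c : nat -> bool) n : set (nat -> bool) :=
  if n is m.+1 then cut (cell c m) (c m) else P.

Lemma cell_good c n : good (cell c n).
Proof.
elim: n => [|n IH] /=; last exact: cut_good.
split; [by []|exact: Pne|by exists 0].
Qed.

Lemma cell_dec c m n : m <= n -> (cell c n `<=` cell c m)%classic.
Proof.
move=> /subnK <-; elim: (n - m) => [|k IH] x //.
by rewrite addSn => -[/IH].
Qed.

Lemma cell_agree c c' n : agree n c c' -> cell c n = cell c' n.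
Proof.
elim: n => //= n IH a; rewrite IH ?a //; exact: agree_le a.
Qed.

(** Each cut freezes the first coordinate that still varies, so [n] cuts freeze at least the first
    [n] coordinates. *)
Lemma cell_const c n x y : cell c n x -> cell c n y -> agree n x y.
Proof.
elim: n x y => // n IH x y [cx bx] [cy by_] i; rewrite ltnS leq_eqVlt =>
    /predU1P[->|].
  have [[u [v [cu cv nuv]]] h] := nxP (cell_good c n).
  case: (ltngtP (nx (cell c n)) n) => [lt|lt|<-]; last by rewrite bx by_.
  - by case: nuv; apply: (IH u v).
  - exact: h cx cy.
exact: IH.
Qed.

Lemma cell_pt c : exists x, forall n, cell c n x.
Proof.
have /choice[p hp] n : exists x, cell c n x by have [] := cell_good c n.
pose x i := p i.+1 i.
have ax m n : m <= n -> agree m x (p n).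
  move=> mn i im; rewrite /x; apply: (@cell_const c i.+1) => //.
  by apply: cell_dec (hp n); apply: leq_trans mn.
exists x => n; have [CP _ [m hm]] := cell_good c n.
apply: (hm (p (maxn m n))).
- by apply: cell_dec (hp _); apply: leq_maxr.
- apply: Pclosed => k; exists (p k); last exact: ax.
  by apply: (cell_dec (c := c) (leq0n k)).
- by apply/agree_sym/ax/leq_maxl.
Qed.

Lemma cell_code x : P x -> exists c, forall n, cell c n x.
Proof.
move=> Px.
pose fix B n : set (nat -> bool) := if n is m.+1 then cut (B m) (x (nx (B m))) else P.
exists (fun n => x (nx (B n))) => n.
have -> : cell (fun n => x (nx (B n))) n = B n by elim: n => //= n ->.
by elim: n => //= n IH.
Qed.

Lemma brouwer : exists f g : (nat -> bool) -> nat -> bool,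
  [/\ forall c, P (g c), cont g, cancel g f,
      forall x, P x -> g (f x) = x &
      forall x k, P x -> exists n, forall y, P y -> agree n x y -> agree k (f x)
          (f y)].
Proof.
have /choice[g hg] := cell_pt.
have /choice[f hf] x : exists c, P x -> forall n, cell c n x.
  have [/cell_code[c hc]|nP] := pselect (P x); first by exists c.
  by exists x.
have codeU c c' x : (forall n, cell c n x) -> (forall n, cell c' n x) -> c = c'.
  move=> h h'; apply: agree_eq; elim=> // n IH i.
  rewrite ltnS leq_eqVlt => /predU1P[->|]; last by apply: IH.
  have [_ e1] := h n.+1; have [_ e2] := h' n.+1.
  by rewrite -e1 -e2 -!/(cell _ n) (cell_agree IH).
have gP c : P (g c) by apply: (hg c 0).
have ptU c x y : (forall n, cell c n x) -> (forall n, cell c n y) -> x = y.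
  by move=> h h'; apply: agree_eq => n; apply: cell_const.
exists f, g; split=> //.
- move=> c k; exists k => c' a.
  by apply: (@cell_const c k); rewrite // (cell_agree a).
- by move=> c; apply: (codeU _ _ (g c)) => //; apply: hf.
- by move=> x Px; apply: (ptU (f x)) => //; apply: hf.
- move=> x k Px; have [_ _ [m hm]] := cell_good (f x) k.
  exists m => y Py a.
  have cy : cell (f x) k y by apply: hm a => //; apply: hf.
  have : cell (f y) k y by apply: hf.
  elim: k cy {hm a m} => // k IH [cy by1] [cy' by2] i.
  have aj := IH cy cy'.
  rewrite ltnS leq_eqVlt => /predU1P[->|]; last exact: aj.
  by rewrite -by1 -by2 -!/(cell _ k) (cell_agree aj).
Qed.

End Brouwer.

(** * Free extensions of groups of homeomorphisms *)

Record homeo := Homeo {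
  hf :> (nat -> bool) -> nat -> bool;
  hi : (nat -> bool) -> nat -> bool;
  hf_cont : cont hf;
  hi_cont : cont hi;
  hfK : cancel hf hi;
  hiK : cancel hi hf }.

Definition hid := Homeo cont_id cont_id (fun=> erefl) (fun=> erefl).

Definition hcomp (f g : homeo) : homeo :=
  Homeo (cont_comp (hf_cont f) (hf_cont g)) (cont_comp (hi_cont g) (hi_cont f))
    (can_comp (hfK f) (hfK g)) (can_comp (hiK g) (hiK f)).

Definition hinv (f : homeo) : homeo :=
  Homeo (hi_cont f) (hf_cont f) (hiK f) (hfK f).

Definition hpow (g : homeo) (e : bool) : homeo := if e then g else hinv g.

Lemma hpowK g e : cancel (hpow g e) (hpow g (~~ e)).
Proof. by case: e => x /=; rewrite ?hfK ?hiK. Qed.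

Definition loc_const (K : Type) (a : (nat -> bool) -> K) :=
  forall x, exists n, forall y, agree n x y -> a x = a y.

Definition upd (x : nat -> bool) n b : nat -> bool :=
  fun i => if i == n then b else x i.

Lemma upd_agree x n b : agree n x (upd x n b).
Proof. by move=> i lt; rewrite /upd ltn_eqF. Qed.

(** A non-empty fibre of a locally constant map is closed and perfect, hence a Cantor set by
    [brouwer]; the fibres of [a] and [b] over the same label are matched through it. *)
Lemma label_homeo (K : Type) (a b : (nat -> bool) -> K) :
  loc_const a -> loc_const b ->
  (forall k, (exists x, a x = k) <-> (exists y, b y = k)) ->
  exists h : homeo, forall x, b (h x) = a x.
Proof.
move=> lca lcb ab.
pose self := ((nat -> bool) -> nat -> bool)%type.
pose chart (c : (nat -> bool) -> K) k (p : self * self) :=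
  [/\ forall x, c (p.2 x) = k, cont p.2, cancel p.2 p.1,
      forall x, c x = k -> p.2 (p.1 x) = x &
      forall x n, c x = k -> exists m, forall y, c y = k -> agree m x y ->
         agree n (p.1 x) (p.1 y)].
have ch c k : loc_const c -> (exists x, c x = k) -> exists p, chart c k p.
  move=> lc ne; have [||//|f [g h]] := @brouwer (fun x => c x = k).
  - move=> x h; have [n hn] := lc x; have [y <- ay] := h n; exact: hn.
  - move=> x n cx; have [m hm] := lc x.
    exists (upd x (maxn m n) (~~ x (maxn m n))); split.
    + by rewrite -(hm _ (agree_le (leq_maxl m n) (@upd_agree _ _ _))).
    + exact: agree_le (leq_maxr m n) (@upd_agree _ _ _).
    + by move/(congr1 (@^~ (maxn m n))); rewrite /upd eqxx; case: (x _).
  by exists (f, g).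
have chc c : loc_const c -> exists p, forall k, (exists x, c x = k) ->
    chart c k (p k).
  move=> lc.
  have /choice[p hp] k : exists p, (exists x, c x = k) -> chart c k p.
    have [/ch[//|p hp]|h] := pselect (exists x, c x = k); first by exists p.
    by exists (id, id).
  by exists p.
have [p hp] := chc a lca; have [q hq] := chc b lcb.
pose tr (c : (nat -> bool) -> K) (r s : K -> self * self) x :=
  (s (c x)).2 ((r (c x)).1 x).
have key c d r s : loc_const c ->
    (forall k, (exists x, c x = k) -> chart c k (r k)) ->
    (forall k, (exists x, c x = k) -> chart d k (s k)) ->
  [/\ forall x, d (tr c r s x) = c x, cont (tr c r s) &
      cancel (tr c r s) (tr d s r)].
  move=> lc hr hs.
  have dt x : d (tr c r s x) = c x by have [|h _ _ _ _] := hs (c x);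
      [exists x|exact: h].
  split=> // [x k|x].
    have [|_ _ _ _ rc] := hr (c x); first by exists x.
    have [|_ sc _ _ _] := hs (c x); first by exists x.
    have [n hn] := sc ((r (c x)).1 x) k; have [m hm] := rc x n erefl.
    have [m' hm'] := lc x.
    exists (maxn m m') => y a_.
    have cxy : c x = c y by apply: hm'; apply: agree_le a_; apply: leq_maxr.
    rewrite /tr -cxy; apply: hn; apply: hm => //.
    by apply: agree_le a_; apply: leq_maxl.
  rewrite /tr -/(tr c r s x) dt.
  have [|_ _ sK _ _] := hs (c x); first by exists x.
  have [|_ _ _ rK _] := hr (c x); first by exists x.
  by rewrite sK rK.
have hq' k : (exists x, a x = k) -> chart b k (q k) by move/ab/hq.
have hp' k : (exists x, b x = k) -> chart a k (p k) by move/ab/hp.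
have [t1 t2 t3] := key a b p q lca hp hq'.
have [u1 u2 u3] := key b a q p lcb hq hp'.
by exists (Homeo t2 u2 t3 u3).
Qed.

(** * Completeness and Baire category in the homeomorphism group *)

Definition near m (g g' : homeo) :=
  forall x, agree m (g x) (g' x) /\ agree m (hi g x) (hi g' x).

Lemma near_refl m g : near m g g. Proof. by []. Qed.

Lemma near_le m n g g' : m <= n -> near n g g' -> near m g g'.
Proof. by move=> mn h x; have [? ?] := h x; split; apply: agree_le mn _. Qed.

Lemma near_trans m g2 g1 g3 : near m g1 g2 -> near m g2 g3 -> near m g1 g3.
Proof.
move=> h k x; have [? ?] := h x; have [? ?] := k x.
by split; [apply: (agree_trans (y := g2 x))|apply: (agree_trans (y := hi g2 x))].
Qed.

Lemma near_pow m g g' e x : near m g g' -> agree m (hpow g e x) (hpow g' e x).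
Proof. by move=> /(_ x)[]; case: e. Qed.

(** Controlling the inverses along with the maps is what makes the limit invertible. *)
Lemma near_limit (g : nat -> homeo) (m : nat -> nat) :
  (forall n, m n < m n.+1) -> (forall n, near (m n) (g n) (g n.+1)) ->
  exists h, forall n, near (m n) (g n) h.
Proof.
move=> mS gS.
have mm i j : i <= j -> m i <= m j.
  move/subnK <-; elim: (j - i) => // k IH; rewrite addSn;
      exact: leq_trans IH (ltnW (mS _)).
have mn n : n <= m n by elim: n => // n IH; apply: leq_ltn_trans IH (mS n).
have gg i j : i <= j -> near (m i) (g i) (g j).
  move/subnK <-; elim: (j - i) => [|k IH]; first exact: near_refl.
  rewrite addSn; apply: near_trans IH _; apply: near_le (gS _).
  by apply: mm; apply: leq_addl.
(* Coordinate [i] is already final in [g i.+1], since [i < m i.+1]. *)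
pose F e x i := hpow (g i.+1) e x i.
have FE e i x : agree (m i) (hpow (g i) e x) (F e x).
  move=> j jm; rewrite /F.
  have [le|lt] := leqP i j.
    by apply: (near_pow e x (gg i j.+1 _)); rewrite // ltnW.
  by apply/esym/(near_pow e x (gg j.+1 i lt)); exact: mn.
have Fc e : cont (F e).
  move=> x k; have [n hn] := hf_cont (hpow (g k) e) x k.
  exists n => y /hn a; have ax := agree_le (mn k) (FE e k x).
  apply: agree_trans (agree_sym ax) _; apply: agree_trans a _.
  exact: agree_le (mn k) (FE e k y).
have FK e : cancel (F e) (F (~~ e)).
  move=> x; apply: agree_eq => k.
  have [n hn] := hf_cont (hpow (g k) (~~ e)) (F e x) k.
  pose N := maxn n k.
  apply: agree_trans (agree_sym (agree_le (mn k) (FE _ k _))) _.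
  have /hn := agree_sym (agree_le (leq_trans (leq_maxl n k) (mn _)) (FE e N x)).
  move=> /agree_trans; apply.
  apply: agree_trans (agree_le (mn k) (near_pow (~~ e) _ (gg k N (leq_maxr _ _)))) _.
  by rewrite hpowK.
exists (Homeo (Fc true) (Fc false) (FK true) (FK false)) => n x.
by split; [exact: (FE true n x)|exact: (FE false n x)].
Qed.

Definition dense_prop (E : homeo -> Prop) :=
  forall g m, exists2 g', near m g g' & E g'.
Definition open_prop (E : homeo -> Prop) :=
  forall g, E g -> exists m, forall g', near m g g' -> E g'.

Lemma baire (E : nat -> homeo -> Prop) :
  (forall j, open_prop (E j)) -> (forall j, dense_prop (E j)) ->
  dense_prop (fun g => forall j, E j g).
Proof.
move=> Eo Ed g0 m0.
have /choice[F hF] (p : nat * (homeo * nat)) : exists q : homeo * nat,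
    [/\ near p.2.2 p.2.1 q.1, p.2.2 < q.2 & forall g', near q.2 q.1 g' -> E p.1 g'].
  case: p => j [g m] /=; have [g' ng' /Eo[m' hm']] := Ed j g m.
  exists (g', maxn m.+1 m'); split; rewrite ?leq_maxl //= => g'' h.
  by apply: hm'; apply: near_le h; apply: leq_maxr.
pose fix s n := if n is k.+1 then F (k, s k) else (g0, m0).
have sP n := hF (n, s n).
have [|n|h hh] := @near_limit (fun n => (s n).1) (fun n => (s n).2).
- by move=> n; have [] := sP n.
- by have [] := sP n.
exists h; first exact: (hh 0).
by move=> j; have [_ _] := sP j; apply; exact: (hh j.+1).
Qed.

Lemma mkseq_agree n x y : mkseq x n = mkseq y n <-> agree n x y.
Proof.
split=> [h i lt|h]; last first.
  apply: (@eq_from_nth _ false); rewrite ?size_mkseq // => i lt.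
  by rewrite !nth_mkseq //; apply: h.
by rewrite -(nth_mkseq false x lt) -(nth_mkseq false y lt) h.
Qed.

(** The map [s] keeps the first [M] bits of [x] and makes bit [N] of [s x] the negation of bit [N]
    of [psi x]; [label_homeo] supplies it. *)
Lemma avoid (psi : homeo) M :
  exists s : homeo, forall x, agree M x (s x) /\ s x <> psi x.
Proof.
have [k hk] := cont_unif M (hi_cont psi).
(* With [N >= M], bit [N] is free once the first [M] bits are fixed; with [N >= k], bit [N] of
   [psi x] can be changed without touching the first [M] bits of [x]. So both labellings have the
   same labels. *)
pose N := maxn M k.
pose a (x : nat -> bool) := (mkseq x M, psi x N).
pose b (y : nat -> bool) := (mkseq y M, ~~ y N).
have lca : loc_const a.
  move=> x; have [n hn] := hf_cont psi x N.+1; exists (maxn n M) => y axy.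
  congr (_, _); first by apply/mkseq_agree/(agree_le _ axy); rewrite leq_maxr.
  by apply: hn => //; apply: (agree_le _ axy); rewrite leq_maxl.
have lcb : loc_const b.
  move=> x; exists N.+1 => y axy; congr (_, _); last by rewrite axy.
  by apply/mkseq_agree/(agree_le _ axy); rewrite leqW // leq_maxl.
have [|s hs] := label_homeo lca lcb.
  move=> [t i]; split=> -[x [<- _]].
    exists (upd x N (~~ i)); rewrite /b /upd eqxx negbK; congr (_, _).
    by apply/esym/mkseq_agree/(agree_le _ (@upd_agree _ _ _))/leq_maxl.
  exists (hi psi (upd (psi x) N i)); rewrite /a hiK /upd eqxx; congr (_, _).
  rewrite -{2}(hfK psi x); apply/esym/mkseq_agree/hk.
  by apply/(agree_le _ (@upd_agree _ _ _))/leq_maxr.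
exists s => x; have [e1 e2] := hs x; split.
  by apply/mkseq_agree; rewrite e1.
by move=> e; move: e2; rewrite e; case: (psi x N).
Qed.

Lemma local_homeo (s : homeo) (P : pred (nat -> bool)) : loc_const P ->
  (forall x, P (s x) = P x) ->
  exists s' : homeo, forall x, s' x = if P x then s x else x.
Proof.
move=> lc Ps.
have Ps' x : P (hi s x) = P x by rewrite -Ps hiK.
have C (f : homeo) : cont (fun x => if P x then f x else x).
  move=> x k; have [n hn] := lc x; have [m hm] := hf_cont f x k.
  exists (maxn k (maxn n m)) => y axy.
  rewrite -(hn y); last by apply: agree_le axy; rewrite !leq_max leqnn !orbT.
  case: ifP => _; last by apply: agree_le axy; rewrite leq_maxl.
  by apply: hm; apply: agree_le axy; rewrite !leq_max leqnn !orbT.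
have K1 : cancel (fun x => if P x then s x else x) (fun x =>
    if P x then hinv s x else x).
  by move=> x; case Px: (P x); rewrite ?Ps Px //= hfK.
have K2 : cancel (fun x => if P x then hinv s x else x) (fun x =>
    if P x then s x else x).
  by move=> x; case Px: (P x); rewrite /= ?Ps' Px //= hiK.
by exists (Homeo (C s) (C (hinv s)) K1 K2).
Qed.

(** [g^e] is precomposed with a map from [avoid], localised to the cylinder of [t]; [n <= m] makes
    that map preserve the cylinder. *)
Lemma perturb (g : homeo) e (psi : homeo) (t : seq bool) n m : n <= m ->
  exists g', [/\ near m g g',
    forall z, mkseq z n = t -> hpow g' e z <> psi z &
    forall z, mkseq z n <> t -> hpow g' e z = hpow g e z].
Proof.
move=> nm; pose k := hpow g e.
have [M0 hM0] := cont_unif m (hf_cont k); pose M := maxn M0 m.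
have [s hs] := avoid (hcomp (hinv k) psi) M.
pose P z := mkseq z n == t.
have [||s' hs'] := @local_homeo s P.
- move=> x; exists n => y a; rewrite /P; congr (_ == _); exact/mkseq_agree.
- move=> x; rewrite /P; congr (_ == _); apply/esym/mkseq_agree.
  by have [+ _] := hs x; apply: agree_le; rewrite leq_max nm orbT.
have s'M x : agree M x (s' x).
  by rewrite hs'; case: ifP => // _; have [] := hs x.
have s'iM x : agree M x (hi s' x).
  by have := s'M (hi s' x); rewrite hiK => /agree_sym.
pose k' := hcomp k s'.
have kk' : near m k k'.
  move=> x; split=> /=.
    by apply: hM0; apply: agree_le (s'M x); rewrite leq_maxl.
  by apply: agree_le (s'iM _); rewrite leq_maxr.
exists (hpow k' e).
have ke : hpow (hpow k' e) e = k' :> (_ -> _) by case: (e).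
split.
- move=> x; have [h1 h2] := kk' x; move: h1 h2; rewrite /k' /k.
  by case: (e).
- move=> z /eqP tz; rewrite ke /k' /= hs' /P tz => h.
  by have [_ []] := hs z => /=; rewrite -h hfK.
- by move=> z /eqP tz; rewrite ke /k' /= hs' /P (negbTE tz).
Qed.

(** * Words over a freely acting group and a new generator, and their fixed points *)

Section FreeExtension.
Variable G : nat -> homeo.
Hypothesis GM : forall i j, exists k, forall x, G k x = G i (G j x).
Hypothesis G1 : exists k, forall x, G k x = x.
Hypothesis Gfree : forall k, (exists x, G k x = x) -> forall x, G k x = x.

(* The word [(e_k, c_k) :: ... :: (e_1, c_1)] with base [c] stands for
   [G c_k g^e_k ... G c_1 g^e_1 G c]. *)
Implicit Types (c : nat) (l : seq (bool * nat)).

Fixpoint ev (g : homeo) c l : homeo :=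
  if l is (e, c') :: l' then hcomp (G c') (hcomp (hpow g e) (ev g c l'))
  else G c.

(** The coefficient between two mutually inverse powers of [g] must move every point; by [Gfree]
    this excludes only the identity. *)
Fixpoint reduced l : Prop :=
  if l is p :: l' then
    (if l' is q :: _ then p.1 = q.1 \/ forall x, G q.2 x <> x else True) /\
    reduced l'
  else True.

Lemma reduced_catl l1 l2 : reduced (l1 ++ l2) -> reduced l1.
Proof.
elim: l1 => //= p [|q l] IH /= [h1 h2]; first by [].
by split=> //; apply: IH.
Qed.

Lemma ev_cat g c l1 e1 c1 l2 x :
  ev g c (l1 ++ (e1, c1) :: l2) x = ev g c1 l1 (hpow g e1 (ev g c l2 x)).
Proof. by elim: l1 => //= -[e c'] l /= ->. Qed.

Lemma ev_near g c l k : exists m, forall g', near m g g' ->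
  forall x, agree k (ev g c l x) (ev g' c l x).
Proof.
elim: l k => [|[e c'] l IH] k; first by exists 0.
have [k1 h1] := cont_unif k (hf_cont (G c')).
have [k2 h2] := cont_unif k1 (hf_cont (hpow g e)).
have [m hm] := IH k2.
exists (maxn m k1) => g' gg' x /=; apply: h1.
apply: (agree_trans (y := hpow g e (ev g' c l x))).
  by apply/h2/hm/(near_le _ gg')/leq_maxl.
by apply/near_pow/(near_le _ gg')/leq_maxr.
Qed.

Lemma separated (f v : homeo) n t :
  (forall x, mkseq (v x) n = t -> f x <> x) ->
  exists k, forall x, mkseq (v x) n = t -> ~ agree k (f x) x.
Proof.
move=> h; have [||N hN] := fan (P := fun k x => mkseq (v x) n = t ->
    ~ agree k (f x) x).
- by move=> i j y ij hy /hy h' a; apply: h'; apply: agree_le a.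
- move=> x; have [m hm] := hf_cont v x n.
  have [e|ne] := eqVneq (mkseq (v x) n) t; last first.
    by exists m => y /hm /mkseq_agree e; move: ne; rewrite e => /eqP.
  have [k hk] := neq_agree (h x e); have [j hj] := hf_cont f x k.
  exists (maxn k j) => y a _ b; apply: hk.
  apply: (agree_trans (y := f y)); first by apply/hj/(agree_le _ a)/leq_maxr.
  apply: (agree_trans (y := y)); first by apply/(agree_le _ b)/leq_maxl.
  by apply/agree_sym/(agree_le _ a)/leq_maxl.
- by exists N.
Qed.

(** Compactness turns the absence of fixed points over a clopen region into a uniform gap, which
    survives small changes of [g]. *)
Lemma robust g c l l' n t :
  (forall x, mkseq (ev g c l' x) n = t -> ev g c l x <> x) ->
  exists m, forall g', near m g g' ->
    forall x, mkseq (ev g' c l' x) n = t -> ~ agree m (ev g' c l x) x.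
Proof.
move=> /separated[k hk].
have [m1 h1] := ev_near g c l k; have [m2 h2] := ev_near g c l' n.
exists (maxn k (maxn m1 m2)) => g' gg' x e a; apply: (hk x).
  rewrite -e; apply/mkseq_agree/h2/(near_le _ gg').
  by rewrite !leq_max leqnn !orbT.
apply: agree_trans (h1 g' _ x) _; last by apply/(agree_le _ a)/leq_maxl.
by apply/(near_le _ gg'); rewrite !leq_max leqnn !orbT.
Qed.

Lemma robust0 g c l : (forall x, ev g c l x <> x) ->
  exists m, forall g', near m g g' -> forall x, ~ agree m (ev g' c l x) x.
Proof.
move=> h; have [m hm] := @robust g c l l 0 [::] (fun x _ => h x).
by exists m => g' gg' x; apply: (hm g').
Qed.

Definition fixfree c l g := forall x, ev g c l x <> x.

Lemma fixfree_open c l : open_prop (fixfree c l).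
Proof.
move=> g /robust0[m hm]; exists m => g' /hm h x e; apply: (h x).
by rewrite e.
Qed.

(* When [g^e] is applied after the word, it may be modified near the point
   where it is applied without affecting the evaluation of the word: that point
   stays away from the points where the earlier letters apply [g^e], and from
   those which the earlier letters apply [g^-e] to reach. *)
Definition tube e g n l := forall l1 e1 c1 l2 y, l = l1 ++ (e1, c1) :: l2 ->
  ~ agree n (ev g c1 l1 (if e1 == e then hpow g e y else y)) y.

(** Induction from the base of the word: if an earlier letter used [g'] where it differs from [g],
    that point and the final one would both lie in the cylinder of [t], against [tube]. *)
Lemma tube_step e g g' n t c l x : tube e g' n l ->
  (forall z, mkseq z n <> t -> hpow g' e z = hpow g e z) ->
  mkseq (ev g' c l x) n = t -> ev g' c l x = ev g c l x.
Proof.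
move=> tb gg' xt.
suff H l1 l2 : l = l1 ++ l2 -> ev g' c l2 x = ev g c l2 x by apply: (H [::]).
elim: l2 l1 => [//|[e1 c1] l2 IH] l1 E.
have /= -> : ev g c ((e1, c1) :: l2) x = G c1 (hpow g e1 (ev g' c l2 x)).
  by rewrite /= -(IH (rcons l1 (e1, c1))) // cat_rcons.
congr (hf (G c1) _); set y := ev g' c l2 x.
have xE : ev g' c l x = ev g' c1 l1 (hpow g' e1 y) by rewrite E ev_cat.
have := tb l1 e1 c1 l2 (if e1 == e then y else hpow g' e1 y) E.
have [ee|ne] := eqVneq e1 e.
  move: xE; rewrite ee => xE; rewrite -xE => na; apply: gg' => yt; apply: na.
  by apply/mkseq_agree; rewrite xt yt.
rewrite -xE => na.
have E1 : e = ~~ e1 by move: ne; case: (e1); case: (e).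
have /gg' : mkseq (hpow g' e1 y) n <> t.
  by move=> yt; apply: na; apply/mkseq_agree; rewrite xt yt.
rewrite E1 hpowK => yE; rewrite {2}yE.
by have := @hpowK g (~~ e1) (hpow g' e1 y); rewrite negbK => ->.
Qed.

(** Each clause of [tube] is a robust form of fixed-point freeness of a reduced word no longer than
    [l], or, when [l1] is empty and the exponents are opposite, of a coefficient controlled by
    [reduced]. The clauses are secured one at a time. *)
Lemma tubes_dense e c0 l g m : reduced ((e, c0) :: l) ->
  (forall c l', size l' <= size l -> l' != [::] -> reduced l' ->
     dense_prop (fixfree c l')) ->
  exists g1 n, [/\ m <= n, near m g g1 & forall g', near n g1 g' -> tube e g' n l].
Proof.
move=> rl IH.
have step l1 e1 c1 l2 g1 n1 : l = l1 ++ (e1, c1) :: l2 ->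
  exists g2 n2, [/\ n1 <= n2, near n1 g1 g2 & forall g', near n2 g2 g' ->
    forall y, ~ agree n2 (ev g' c1 l1 (if e1 == e then hpow g' e y else y)) y].
  move=> E.
  have sl : size (rcons l1 (e1, c1)) <= size l.
    by rewrite E size_rcons size_cat /= -addSnnS leq_addr.
  have rl1 : reduced ((e, c0) :: rcons l1 (e1, c1)).
    by move: rl; rewrite E -cat_rcons -cat_cons => /reduced_catl.
  suff [c [l' [Ed El']]] : exists c l', dense_prop (fixfree c l') /\
      forall g y, ev g c1 l1 (if e1 == e then hpow g e y else y) = ev g c l' y.
    have [g2 n12 /robust0[n2 h2]] := Ed g1 n1.
    exists g2, (maxn n1 n2); split=> //; first exact: leq_maxl.
    move=> g' gg' y; rewrite El' => a.
    apply: (h2 g' _ y); first by apply: near_le gg'; apply: leq_maxr.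
    by apply: agree_le a; apply: leq_maxr.
  have [ee|ne] := eqVneq e1 e.
    have [k1 hk1] := G1.
    exists k1, (rcons l1 (e1, c1)); split.
      by apply: IH => //; [case: (l1)|case: rl1].
    by move=> g' y; rewrite -cats1 ev_cat /= hk1 ee.
  exists c1, l1; split=> //.
  have [l10|l10] := eqVneq l1 [::].
    move=> g' m'; exists g' => // x; rewrite l10 /=.
    move: rl; rewrite E l10 /= => -[[h|h] _]; last exact: h.
    by rewrite h eqxx in ne.
  apply: IH => //; first by rewrite E size_cat leq_addr.
  by move: rl => [_]; rewrite E => /reduced_catl.
suff H l2 l1 : l = l1 ++ l2 -> exists g1 n, [/\ m <= n, near m g g1 &
    forall g', near n g1 g' -> forall l3 e1 c1 l4 y, l2 = l3 ++ (e1, c1) :: l4 ->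
    ~ agree n (ev g' c1 (l1 ++ l3) (if e1 == e then hpow g' e y else y)) y].
  by apply: (H l [::]).
elim: l2 l1 => [|[e1 c1] l2 IHl] l1 E.
  by exists g, m; split=> // g' _ [|? ?].
have [|g1 [n1 [mn1 gg1 h1]]] := IHl (rcons l1 (e1, c1)); first by rewrite cat_rcons.
have [g2 [n2 [n12 g12 h2]]] := step _ _ _ _ g1 n1 E.
exists g2, n2; split; first exact: leq_trans n12.
  by apply: near_trans gg1 _; apply: near_le g12.
move=> g' g2' [|p l3] e2 c2 l4 y /=.
  by case=> <- <- _; rewrite cats0; apply: h2.
case=> <- El2 a; apply: (h1 g' _ l3 e2 c2 l4 y El2).
  by apply: near_trans g12 _; apply: near_le g2'.
by rewrite cat_rcons; apply: agree_le a.
Qed.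

(** Only the letter applied last is perturbed, cylinder by cylinder. The tubes ensure that changing
    [g^e] there does not move the point it is applied to, so its value can be steered away from the
    single one that creates a fixed point. *)
Lemma fixfree_dense c l : l != [::] -> reduced l -> dense_prop (fixfree c l).
Proof.
have [s] := ubnP (size l); elim: s l c => // s IH [|[e c0] l] // c sl _ rl g m.
have {}IH c' l' : size l' <= size l -> l' != [::] -> reduced l' ->
    dense_prop (fixfree c' l').
  by move=> sl'; apply: IH; apply: leq_ltn_trans sl' _.
have [g1 [n [mn gg1 tb]]] := tubes_dense g m rl IH.
suff H (S : seq (seq bool)) : exists g2 m2, [/\ n <= m2, near n g1 g2 &
    forall g', near m2 g2 g' -> forall x, mkseq (ev g' c l x) n \in S ->
      ev g' c ((e, c0) :: l) x <> x].
  have [g2 [m2 [_ g12 h]]] := H (map val (enum {: n.-tuple bool})).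
  exists g2; first by apply: near_trans gg1 _; apply: near_le g12.
  move=> x; apply: (h g2 (near_refl _ _)).
  set z := ev _ _ _ _; have sz : size (mkseq z n) == n by rewrite size_mkseq.
  by apply/mapP; exists (Tuple sz) => //; rewrite mem_enum.
elim: S => [|t S [g2 [m2 [nm2 g12 h2]]]]; first by exists g1, n; split.
(* For [z = ev g2 c l x], the whole word fixes [x] exactly if [g^e] takes the value [psi z] at
   [z]. *)
pose psi := hcomp (hinv (G c0)) (hinv (ev g2 c l)).
have [g3 [g23 av off]] := perturb g2 e psi t nm2.
have g13 : near n g1 g3 by apply: near_trans g12 _; apply: near_le g23.
have [|m3 h3] := @robust g3 c ((e, c0) :: l) l n t.
  move=> x xt; have E := tube_step (tb _ g13) off xt.
  move=> /= fx; apply: (av _ xt); rewrite -[hpow g3 e _](hfK (G c0)) fx.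
  by rewrite /psi /= E hfK.
exists g3, (maxn m2 m3); split=> //; first by apply: leq_trans (leq_maxl _ _).
move=> g' g3' x; rewrite inE => /predU1P[xt|xS].
  move=> fx; apply: (h3 g' _ x xt); first by apply: near_le g3'; apply: leq_maxr.
  by rewrite fx.
apply: h2 xS; apply: near_trans g23 _; apply: near_le g3'; exact: leq_maxl.
Qed.

Fixpoint wev (g : homeo) (w : seq (nat + bool)) : homeo :=
  if w is a :: w' then
    hcomp (match a with inl k => G k | inr e => hpow g e end) (wev g w')
  else hid.

(** A coefficient with a fixed point is the identity by [Gfree], so inverse powers around it cancel;
    otherwise prolonging the word keeps it reduced. *)
Lemma wev_reduced g w : exists c l, reduced l /\ forall x, wev g w x = ev g c l x.
Proof.
have [k1 hk1] := G1.
elim: w => [|a w [c [l [rl h]]]]; first by exists k1, [::]; split=> // x /=;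
    rewrite hk1.
case: a => [k|e].
  case: l rl h => [|[e1 c1] l] rl h.
    have [j hj] := GM k c; exists j, [::]; split=> // x /=.
    by rewrite h /= hj.
  have [j hj] := GM k c1; exists c, ((e1, j) :: l); split=> // x.
  by rewrite /= h /= hj.
case: l rl h => [|[e1 c1] l] rl h.
  by exists c, [:: (e, k1)]; split=> // x; rewrite /= h hk1.
have [ee|ne] := eqVneq e e1.
  exists c, ((e, k1) :: (e1, c1) :: l); split; first by split=> //; left.
  by move=> x; rewrite /= h /= hk1.
have [/Gfree c1x|nf] := pselect (exists x, G c1 x = x); last first.
  exists c, ((e, k1) :: (e1, c1) :: l); split.
    by split=> //; right=> x fx; apply: nf; exists x.
  by move=> x; rewrite /= h /= hk1.
exists c, l; split; first by case: rl.
move=> x; rewrite /= h /= c1x.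
have -> : e = ~~ e1 by move: ne; case: (e); case: (e1).
by rewrite hpowK.
Qed.

Lemma free_extension g0 m : exists2 g, near m g0 g &
  forall w, (exists x, wev g w x = x) -> forall x, wev g w x = x.
Proof.
pose E (j : nat) (g : homeo) := if unpickle j is Some (c, l) then
  l != [::] -> reduced l -> fixfree c l g else True.
have [j|j|g ng hg] := @baire E _ _ g0 m.
- rewrite /E => g; case: unpickle => [[c l]|_]; last by exists 0.
  have [[l0 rl]|nrl] := pselect (l != [::] /\ reduced l).
    by move=> /(_ l0 rl) /fixfree_open[m' h]; exists m' => g' /h.
  by move=> _; exists 0 => g' _ l0 rl; case: nrl.
- rewrite /E => g m'; case: unpickle => [[c l]|]; last by exists g.
  have [[l0 rl]|nrl] := pselect (l != [::] /\ reduced l).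
    by have [g' ? h] := fixfree_dense c l0 rl g m'; exists g'.
  by exists g => // l0 rl; case: nrl.
exists g => // w [x fx] y; have [c [l [rl h]]] := wev_reduced g w.
have [l0|l0] := eqVneq l [::].
  move: fx; rewrite !h l0 /= => fx; apply: Gfree; by exists x.
have := hg (pickle (c, l)); rewrite /E pickleK => /(_ l0 rl x).
by rewrite -h fx.
Qed.

End FreeExtension.

(** * Splitting a point *)

Lemma inj_unbounded (f : nat -> nat) : injective f -> forall k, exists j, k <= f j.
Proof.
move=> fI k; apply: contrapT => /forallNP h.
suff : size (map f (iota 0 k.+1)) <= size (iota 0 k).
  by rewrite size_map !size_iota ltnn.
apply: uniq_leq_size => [|_ /mapP[j _ ->]];
    first by rewrite map_inj_uniq // iota_uniq.
by rewrite mem_iota add0n /= ltnNge; apply/negP.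
Qed.

(* The function is constant on each ring between two consecutive members of a
   fast shrinking neighbourhood base of [x]. *)
Lemma split_fun (x : nat -> bool) (A : nat -> set (set (nat -> bool))) :
  (forall m k, exists2 phi, A m phi & (forall z, phi z -> agree k x z) /\
     exists k', forall z, phi z -> ~ agree k' x z) ->
  exists f : (nat -> bool) -> bool,
    (forall z, z <> x -> exists k, forall z', agree k z z' -> f z' = f z) /\
    (forall m i k, exists2 phi, A m phi & forall z, phi z -> agree k x z /\ f z = i).
Proof.
move=> hA.
have /choice[F hF] (p : nat * nat) : exists q : set (nat -> bool) * nat,
    [/\ A p.1 q.1, forall z, q.1 z -> agree p.2 x z &
        forall z, q.1 z -> ~ agree q.2 x z].
  by have [phi ? [? [k ?]]] := hA p.1 p.2; exists (phi, k).
(* Ring [n] serves the request coded by [n]: family [m], value [i], and a counter [j] that repeats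
   the request at arbitrarily small scales. *)
pose dec n : nat * bool * nat := odflt (0, true, 0) (unpickle n).
pose fix s n := if n is k.+1 then maxn (s k).+1 (F ((dec k).1.1, s k)).2 else 0.
have sS n : s n < s n.+1 by rewrite leq_maxl.
have smono i j : i <= j -> s i <= s j.
  by move/subnK <-; elim: (j - i) => // k IH; rewrite addSn;
      apply: leq_trans IH (ltnW (sS _)).
have sn n : n <= s n by elim: n => // n IH; apply: leq_ltn_trans IH (sS n).
pose ring n z := agree (s n) x z /\ ~ agree (s n.+1) x z.
have ringU i j z : ring i z -> ring j z -> i = j.
  have H a b : ring a z -> ring b z -> ~ a < b.
    by move=> [_ na] [ab _] lt; apply: na; apply: agree_le ab; apply: smono.
  move=> ri rj; case: (ltngtP i j) => //.
    by move/(H _ _ ri rj).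
  by move/(H _ _ rj ri).
pose f z := `[< exists2 n, ring n z & (dec n).1.2 >].
have fE n z : ring n z -> f z = (dec n).1.2.
  move=> rn; apply/asboolP/idP => [[n' rn' h]|h]; last by exists n.
  by rewrite (ringU _ _ _ rn rn').
have ring_ex z : z <> x -> exists n, ring n z.
  move=> zx; have [k hk] := neq_agree (nesym zx).
  have ex : exists n, `[< ~ agree (s n) x z >].
    by exists k; apply/asboolP => a; apply: hk; apply: agree_le a.
  case: (ex_minnP ex) => -[|n] /asboolP nn mn; first by case: nn.
  exists n; split=> //; apply: contrapT => h.
  by have := mn n; rewrite ltnn => /(_ _)/notF; apply; apply/asboolP.
exists f; split=> [z zx|m i k].
  have [n rn] := ring_ex z zx; exists (s n.+1) => z' zz'.
  rewrite (fE n z) //; apply: fE; case: rn => a na; split.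
    by apply: agree_trans a (agree_le (ltnW (sS n)) zz').
  by move=> h; apply: na; apply: agree_trans h (agree_sym zz').
have [|j kj] := @inj_unbounded (fun j => pickle (m, i, j)) _ k.
  by move=> j j' /(pcan_inj pickleK)[].
set n := pickle _ in kj.
have dn : dec n = (m, i, j) by rewrite /dec pickleK.
have [h1 h2 h3] := hF (m, s n); exists (F (m, s n)).1 => // z hz; split.
  by apply: agree_le (h2 z hz); apply: leq_trans kj (sn n).
rewrite (fE n) ?dn //; split; first exact: h2.
by move=> a; apply: (h3 z hz); apply: agree_le a; rewrite /= dn leq_maxr.
Qed.

Local Open Scope classical_set_scope.

(** * The order type omega_1 *)

Lemma countable_setU (T : Type) (A B : set T) :
  countable A -> countable B -> countable (A `|` B).
Proof. by move=> cA cB; rewrite -bigcup2E; apply: bigcup_countable =>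
    // -[|[|n]]. Qed.

Lemma countable_image (T U : Type) (f : T -> U) (A : set T) :
  countable A -> countable (f @` A).
Proof. exact/sub_countable/card_image_le. Qed.

Section Omega1.
Local Open Scope order_scope.
Context {d : Order.disp_t} (W : orderType d).
Hypothesis hW : is_omega1 W.
Implicit Types (a b c : W).

Lemma ltW_wf : well_founded (fun a b : W => a < b).
Proof.
have [wo _ _] := hW => a; apply: contrapT => na.
have [|m [[+ mmin] _]] := wo (fun b => `[< ~ Acc (fun a b : W => a < b) b >]).
  by exists a; apply/asboolP.
move=> /asboolP; apply; constructor => b bm; apply: contrapT => nb.
by have := mmin b; rewrite leNgt bm => /(_ _)/notF; apply; apply/asboolP.
Qed.

Lemma ltW_ind (P : W -> Prop) :
  (forall a, (forall b, b < a -> P b) -> P a) -> forall a, P a.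
Proof. by move=> h; apply: (well_founded_ind ltW_wf). Qed.

Lemma countable_bounded (S : set W) : countable S ->
  exists a, forall b, S b -> b < a.
Proof.
move=> cS; have [_ unc ini] := hW; apply: contrapT => /forallNP h; apply: unc.
apply: (@sub_countable _ _ _ (\bigcup_(b in S) [set c | c <= b])).
  apply: subset_card_le => a _; have /existsNP[b /not_implyP[Sb /negP]] := h a.
  by rewrite -leNgt => ab; exists b.
apply: bigcup_countable => // b _.
apply: (@sub_countable _ _ _ ([set c | c < b] `|` [set b])).
  by apply: subset_card_le => c /=; rewrite le_eqVlt => /predU1P[->|]; [right|left].
by apply: countable_setU => //; apply: finite_set_countable.
Qed.

Lemma range_bounded (f : nat -> W) : exists a, forall n, f n < a.
Proof.
have [|a ha] := @countable_bounded (range f); first exact: countable_image.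
by exists a => n; apply: ha; exists n.
Qed.

Lemma W_inhabited : exists a : W, True.
Proof.
have [_ unc _] := hW; apply: contrapT => /forallNP h; apply: unc.
suff -> : [set: W] = set0 by [].
by apply/seteqP; split=> // a; have := h a.
Qed.

(** Transfinite recursion with an invariant: [P c H] looks at [H] only up to [c], so a stage stays
    valid however the recursion continues. *)
Lemma W_rec (D : Type) (d0 : D) (P : W -> (W -> D) -> Prop) :
  (forall c (H H' : W -> D), (forall b, b <= c -> H b = H' b) -> P c H -> P c H') ->
  (forall c (H : W -> D), (forall b, b < c -> P b H) ->
     exists x, P c (fun b => if b == c then x else H b)) ->
  exists H, forall c, P c H.
Proof.
move=> loc step.
have /choice[F hF] (p : W * (W -> D)) : exists x,
    (forall b, b < p.1 -> P b p.2) ->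
    P p.1 (fun b => if b == p.1 then x else p.2 b).
  have [/step[x hx]|nh] := pselect (forall b, b < p.1 -> P b p.2); first by exists x.
  by exists d0.
pose body a (H : forall b, b < a -> D) :=
  F (a, fun b => if pselect (b < a) is left h then H b h else d0).
pose H := Fix ltW_wf (fun=> D) body.
have HE a : H a = F (a, fun b => if b < a then H b else d0).
  rewrite /H Fix_eq; last first.
    move=> x f g fg; congr (body _ _).
    by do 2![apply: functional_extensionality_dep => ?].
  rewrite /body; congr (F (_, _)); apply: funext => b.
  by case: pselect => [->|/negP/negbTE ->].
exists H; apply: ltW_ind => c IH.
apply: (loc c) (hF (c, fun b => if b < c then H b else d0) _) => /=.
  by move=> b; rewrite le_eqVlt; case: eqP => [->|_ /= ->].
move=> b bc; apply: loc (IH b bc) => a ab.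
by rewrite (le_lt_trans ab bc).
Qed.

Lemma enum_below : exists f : W -> nat -> W,
  (forall c n, f c n <= c) /\ forall c b, b <= c -> exists n, f c n = b.
Proof.
suff /choice[f hf] c : exists f : nat -> W,
    (forall n, f n <= c) /\ forall b, b <= c -> exists n, f n = b.
  by exists f; split=> [c|c b]; have [? h] := hf c => //; apply: h.
have [_ _ /(_ c)/countable_injP[g gI]] := hW.
have /choice[f hf] n : exists b, b <= c /\ ((exists a, a < c /\ g a = n) ->
    b < c /\ g b = n).
  have [[a [ac an]]|h] := pselect (exists a, a < c /\ g a = n).
    by exists a; split=> //; apply: ltW.
  by exists c; split.
exists (fun n => if n is k.+1 then f k else c); split=> [[|n]|b] //.
  by have [] := hf n.
rewrite le_eqVlt => /predU1P[->|bc]; first by exists 0%N.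
exists (g b).+1; have [_ []] := hf (g b); first by exists b.
by move=> fc; apply: gI; rewrite inE.
Qed.

(** Increasing sequences are stacked: the values of [e c] lie above all those of [e b] for [b < c],
    which are countably many and hence bounded. *)
Lemma code_exists : exists e : W -> nat -> W,
  forall a m b n, e a m = e b n -> a = b /\ m = n.
Proof.
have [a0 _] := W_inhabited.
have /choice[s hs] a : exists b, a < b.
  by have [b hb] := range_bounded (fun=> a); exists b; apply: (hb 0%N).
have [||e he] := @W_rec (nat -> W) (fun=> a0) (fun c H =>
  (forall m n, (m < n)%N -> H c m < H c n) /\
  forall b, b < c -> forall m n, H b m < H c n).
- move=> c H H' HH [h1 h2].
  by split=> [m n /h1|b bc m n]; rewrite -(HH c) // -(HH b) ?ltW //; apply: h2.
- move=> c H _.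
  have [_ _ cc] := hW.
  have [|u hu] := @countable_bounded (\bigcup_(b in [set b | b < c]) range (H b)).
    by apply: bigcup_countable => // b _; apply: countable_image.
  pose f n := iter n s u.
  have fm m n : (m < n)%N -> f m < f n.
    elim: n => // n IH; rewrite ltnS leq_eqVlt => /predU1P[->|/IH lt];
        first exact: hs.
    exact: lt_trans lt (hs _).
  exists f; rewrite eqxx; split=> // b bc m n; rewrite (lt_eqF bc).
  have : H b m < u by apply: hu; exists b => //; exists m.
  by case: n => // n lt; apply: lt_trans lt (fm 0%N n.+1 _).
exists e => a m b n E; have [ab ba] : ~ a < b /\ ~ b < a.
  split=> lt.
    by have [_ /(_ _ lt m n)] := he b; rewrite E ltxx.
  by have [_ /(_ _ lt n m)] := he a; rewrite E ltxx.
have {}ab : a = b by case: (ltgtP a b) ab ba.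
move: E; rewrite -ab => E; split=> //.
by case: (ltngtP m n) => // lt; have [/(_ _ _ lt)] := he a; rewrite E ltxx.
Qed.

(** For unboundedness, the least strict upper bound is taken of an omega-sequence in which each term
    bounds the values of [f] up to the previous term. *)
Lemma club_closed (f : W -> nat -> W) a0 :
  club [set c | a0 < c /\ forall b, b < c -> forall n, f b n < c].
Proof.
split=> [a [b ba] cof|a].
  have [c [a0c _] /andP[_ ca]] := cof b ba.
  split=> [|b' b'a n]; first exact: lt_trans ca.
  by have [c' [_ h] /andP[bc' c'a]] := cof b' b'a; apply: lt_trans c'a; apply: h.
have [_ _ ini] := hW.
have /choice[s hs] u : exists v, u < v /\ forall b, b <= u -> forall n, f b n < v.
  have [|v hv] := @countable_bounded
    (\bigcup_(b in [set b | b < u] `|` [set u]) range (f b) `|` [set u]).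
    apply: countable_setU; last exact: finite_set_countable.
    apply: bigcup_countable; last by move=> *; exact: countable_image.
    by apply: countable_setU; [exact: ini|exact: finite_set_countable].
  exists v; split=> [|b bu n]; first by apply: hv; right.
  apply: hv; left; exists b; last by exists n.
  by move: bu; rewrite le_eqVlt => /predU1P[->|]; [right|left].
pose u n := iter n s (Order.max a a0).
have [v hv] := range_bounded u.
have [wo _ _] := hW.
have [|m [[+ mmin] _]] := wo (fun b => `[< forall n, u n < b >]).
  by exists v; apply/asboolP.
move=> /asboolP hm; exists m; last by apply: le_lt_trans (hm 0%N);
    rewrite le_max lexx.
split; first by apply: le_lt_trans (hm 0%N); rewrite le_max lexx orbT.
move=> b bm n.
have [k hk] : exists k, b <= u k.
  apply: contrapT => /forallNP h.
  suff : m <= b by rewrite leNgt bm.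
  apply: mmin; apply/asboolP => k; rewrite ltNge; apply/negP; exact: h.
by apply: lt_trans (hm k.+1); have [_ /(_ b hk n)] := hs (u k).
Qed.

End Omega1.

(** * The inverse system *)

Section System.
Local Open Scope order_scope.
Context {d : Order.disp_t} (W : orderType d).
Hypothesis hW : is_omega1 W.
Variable en : W -> nat -> W.
Hypothesis en_le : forall c n, en c n <= c.
Hypothesis en_surj : forall c b, b <= c -> exists n, en c n = b.

Notation idx := (option W * nat)%type.
Notation pt := (option W * nat -> bool).
Notation word := (seq (W * bool)).
Implicit Types (a c g : W) (o : option W) (i : idx) (z : pt) (w : word).

(* Points are functions on [option W * nat]: the coordinates [(None, n)] are
   those of the initial Cantor set, and the block [(Some c, n)] is added by the
   splitting at stage [c].  [restr (Some c) z] is the projection of [z] to stage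
   [c], padded with [false]. *)
Definition below o i : bool :=
  match i.1, o with
  | None, _ => true
  | Some b, Some c => b < c
  | Some _, None => false
  end.

Definition lev_le o o' : bool :=
  match o, o' with
  | None, _ => true
  | Some b, Some c => b <= c
  | Some _, None => false
  end.

Lemma lele_refl o : lev_le o o. Proof. by case: o => /=. Qed.

Lemma below_le o o' i : lev_le o o' -> below o i -> below o' i.
Proof.
case: o o' i => [b|] [c|] [[g|] n] //= bc gb; exact: lt_le_trans gb bc.
Qed.

Lemma notbelow o b n : ~~ below o (Some b, n) -> lev_le o (Some b).
Proof. by case: o => [c|] //=; rewrite /below /= -leNgt. Qed.

Definition restr o z : pt := fun i => below o i && z i.

Lemma restrE o z i : below o i -> restr o z i = z i.
Proof. by rewrite /restr => ->. Qed.

Lemma restr_restr o o' z : lev_le o o' -> restr o (restr o' z) = restr o z.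
Proof.
move=> oo; apply: funext => i; rewrite /restr.
by case bo: (below o i) => //=; rewrite (below_le oo bo).
Qed.

Lemma restr_eq o o' z y : lev_le o o' -> restr o' z = restr o' y ->
    restr o z = restr o y.
Proof. by move=> oo h; rewrite -(restr_restr z oo) h restr_restr. Qed.

Lemma restr_eqP o z y : restr o z = restr o y <-> forall i, below o i -> z i = y i.
Proof.
split=> [h i bi|h]; first by rewrite -(restrE z bi) h restrE.
by apply: funext => i; rewrite /restr; case bi: (below o i) => //=; apply: h.
Qed.

Definition agr (s : seq idx) z y := forall i, i \in s -> z i = y i.

Lemma agr_sym s z y : agr s z y -> agr s y z.
Proof. by move=> h i /h. Qed.

Lemma agr_cat s1 s2 z y : agr (s1 ++ s2) z y <-> agr s1 z y /\ agr s2 z y.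
Proof.
split=> [h|[h1 h2] i]; last by rewrite mem_cat => /orP[/h1|/h2].
by split=> i hi; apply: h; rewrite mem_cat hi ?orbT.
Qed.

Lemma agr_restr s o z y : agr [seq i <- s | below o i] z y -> agr s (restr o z)
    (restr o y).
Proof.
move=> h i si; rewrite /restr; case bi: (below o i) => //=.
by apply: h; rewrite mem_filter bi.
Qed.

Lemma agr_restr_eq s o z z' y : all (below o) s -> restr o z = restr o z' ->
  agr s z y -> agr s z' y.
Proof.
move=> /allP so /restr_eqP h a i si; rewrite -h ?a //; exact: so.
Qed.

Lemma agr_restrW s o z y : all (below o) s -> agr s (restr o z) (restr o y) ->
    agr s z y.
Proof. by move=> /allP so h i si; have := h i si; rewrite (restrE z (so _ si))
    (restrE y (so _ si)). Qed.

(** * Words in the generators and enumerations of coordinates *)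

Definition word_le c w := all (fun l => l.1 <= c) w.

Definition word_enum c n : word :=
  [seq (en c p.1, p.2) | p <- odflt [::] (unpickle n : option (seq (nat * bool)))].

Lemma word_enum_le c n : word_le c (word_enum c n).
Proof. by apply/allP => _ /mapP[p _ ->] /=. Qed.

Lemma word_enum_surj c w : word_le c w -> exists n, word_enum c n = w.
Proof.
move=> cw; suff [s <-] : exists s : seq (nat * bool), [seq (en c p.1, p.2)
    | p <- s] = w.
  by exists (pickle s); rewrite /word_enum pickleK.
elim: w cw => [|[b e] w IH] /=; first by exists [::].
move=> /andP[/en_surj[n <-] /IH[s <-]].
by exists ((n, e) :: s).
Qed.

(* The coordinate [(Some c, n)] is indexed by the word [word_enum c n]; a word
   may index several coordinates. *)
Definition word_code c w : nat :=
  if pselect (exists n, word_enum c n = w) is left h then projT1 (cid h) else 0.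

Lemma word_codeK c w : word_le c w -> word_enum c (word_code c w) = w.
Proof.
by move=> /word_enum_surj h; rewrite /word_code; case: pselect => // h'; case: cid.
Qed.

(** [en c] also lists [c], whose block is not below [c]; that value falls back on the initial
    coordinates. *)
Definition coord c (m : nat) : idx :=
  let: (k, n) := odflt (0, 0)%N (unpickle m) in
  if k is k'.+1 then if en c k' < c then (Some (en c k'), n) else (None, n)
  else (None, n).

Lemma coord_below c m : below (Some c) (coord c m).
Proof.
rewrite /coord; case: (odflt _ _) => -[|k] n //=.
by case: ifP.
Qed.

Lemma coord_surj c i : below (Some c) i -> exists m, coord c m = i.
Proof.
case: i => [[b|] n] h; last by exists (pickle (0, n)%N); rewrite /coord pickleK.
have [k bk] := en_surj (ltW h).
by exists (pickle (k.+1, n)%N); rewrite /coord pickleK /= bk; move: h;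
    rewrite /below /= => ->.
Qed.

Definition word_inv w : word := rev [seq (l.1, ~~ l.2) | l <- w].

Lemma winvK : involutive word_inv.
Proof.
move=> w; rewrite /word_inv map_rev revK -map_comp.
by rewrite -[RHS]map_id; apply: eq_map => -[b e] /=; rewrite negbK.
Qed.

Lemma winv_cat w w' : word_inv (w ++ w') = word_inv w' ++ word_inv w.
Proof. by rewrite /word_inv map_cat rev_cat. Qed.

Lemma winv_cons l w : word_inv (l :: w) = word_inv w ++ [:: (l.1, ~~ l.2)].
Proof. by rewrite -cat1s winv_cat. Qed.

Lemma word_le_cat c w w' : word_le c (w ++ w') = word_le c w && word_le c w'.
Proof. exact: all_cat. Qed.

Lemma word_le_inv c w : word_le c (word_inv w) = word_le c w.
Proof. by rewrite /word_le /word_inv all_rev all_map. Qed.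

Lemma word_le_le b c w : b <= c -> word_le b w -> word_le c w.
Proof. by move=> bc; apply: sub_all => l lb; apply: le_trans bc. Qed.

(* At stage [c] the orbit of [split_pt] is split according to [split_side],
   after the homeomorphism [stage_map true], with inverse [stage_map false],
   has been added. *)
Record data := Data {
  split_pt : pt;
  split_side : pt -> bool;
  stage_map : bool -> pt -> pt }.

Definition base : set pt := [set a | restr None a = a].
Variable guesses : W -> set pt.
Definition promised o := if o is Some c then guesses c else base.

(** A finite union of cylinders, each a list of prescribed coordinates. The type is countable, so a
    clopen set can be coded by a number and guessed. *)
Definition pattern := seq (seq (nat * bool)).
Definition matches a (u : pattern) z : bool :=
  has (fun p => all (fun q => z (coord a q.1) == q.2) p) u.
Variable task_at : W -> W * (pattern * pattern).

Lemma matches_restr a c u z y : a <= c -> restr (Some c) z = restr (Some c) y ->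
    matches a u z = matches a u y.
Proof.
move=> ac /restr_eqP h; apply: eq_has => p; apply: eq_all => q.
by rewrite h //; apply: below_le (coord_below _ _).
Qed.

Lemma matches_loc a u z : exists2 s, all (below (Some a)) s &
  forall y, agr s z y -> matches a u z = matches a u y.
Proof.
exists [seq coord a q.1 | q <- flatten u].
  by apply/allP => _ /mapP[q _ ->]; apply: coord_below.
move=> y h; apply: eq_in_has => p pu; apply: eq_in_all => q qp.
by rewrite h //; apply: map_f; apply/flattenP; exists p.
Qed.

(** * The lifted action and the coherent points for a given history *)

Section History.
Variable H : W -> data.

(* A generator acts on the old coordinates by the homeomorphism chosen at its
   stage, and shifts the coordinates of each later block. *)
Definition gen_act c (e : bool) z : pt := fun i =>
  if below (Some c) i then stage_map (H c) e (restr (Some c) z) i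
  else if i is (Some g, n) then
    z (Some g, word_code g ((c, ~~ e) :: word_enum g n))
  else false.

Definition word_act w z := foldr (fun l => gen_act l.1 l.2) z w.

Definition sided g (b : bool) y :=
  if `[< y = split_pt (H g) >] then b else split_side (H g) y.

(* The block [g] of [z] lists the values of the split function along the orbit
   of [z]; the bit [b] is the side chosen at the split point. *)
Definition coherent_side g (b : bool) z :=
  forall n, z (Some g, n) = sided g b (restr (Some g)
      (word_act (word_inv (word_enum g n)) z)).

Definition coherent g z := exists b, coherent_side g b z.
Definition coherent_below c z := forall g, g < c -> coherent g z.
Definition level c z := restr (Some c) z = z /\ coherent_below c z.

Definition level_cont c (f : pt -> pt) := forall z i, level c z ->
  exists s, forall y, level c y -> agr s z y -> f z i = f y i.

Definition homeo_at c := forall e,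
  [/\ forall z, level c z -> level c (stage_map (H c) e z),
      forall z, level c z -> stage_map (H c) (~~ e) (stage_map (H c) e z) = z &
      level_cont c (stage_map (H c) e)].

(* Words need not be reduced, so a word acting trivially is allowed. *)
Definition free c := forall w, word_le c w ->
  (exists2 z, level c z & restr (Some c) (word_act w z) = z) ->
  forall z, level c z -> restr (Some c) (word_act w z) = z.

Definition accum_pt (A : set pt) y := forall s, exists2 a, A a & a <> y /\ agr s a y.

Definition cont_off c x f := forall z, level c z -> z <> x ->
  exists s, forall y, level c y -> agr s z y -> f y = f z :> bool.

(** Fibres over points of [promised o] near [w x] are pulled back to [x] along [w]. Both values of
    [f] occur on whole such fibres arbitrarily near [x], so that each of the two points replacing
    [x] inherits the promise. *)
Definition splits c x f := forall o w, lev_le o (Some c) -> word_le c w ->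
  accum_pt (promised o) (restr o (word_act w x)) -> forall (e : bool) s,
      all (below (Some c)) s ->
  exists2 a, promised o a & a <> restr o (word_act w x) /\
    forall z, level c z -> restr o (word_act w z) = a -> agr s z x /\ f z = e.

Definition task c := forall a u v, task_at c = (a, (u, v)) -> a <= c ->
  (exists2 z, level c z & matches a u z) -> (exists2 z, level c z &
      ~~ matches a u z) ->
  (exists2 z, level c z & matches a v z) -> (exists2 z, level c z &
      ~~ matches a v z) ->
  forall z, level c z -> matches a v (stage_map (H c) true z) = matches a u z.

Definition aims c x := (exists2 z, level c z & accum_pt (guesses c) z) ->
    accum_pt (guesses c) x.

Definition good_stage c :=
  [/\ homeo_at c, free c, level c (split_pt (H c)) /\ aims c (split_pt (H c)),
      cont_off c (split_pt (H c)) (split_side (H c)) /\ splits c (split_pt (H c))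
          (split_side (H c)) & task c].

Lemma gen_local c g e z y : c <= g ->
  restr (Some g) z = restr (Some g) y -> restr (Some g) (gen_act c e z)
      = restr (Some g) (gen_act c e y).
Proof.
move=> cg h; apply/restr_eqP => -[[g'|] n] /= bi; rewrite /gen_act.
  case: ifP => bc; first by rewrite (restr_eq _ h).
  by move/restr_eqP: h; apply.
by rewrite (restr_eq _ h).
Qed.

Lemma act_local g w z y : word_le g w ->
  restr (Some g) z = restr (Some g) y -> restr (Some g) (word_act w z)
      = restr (Some g) (word_act w y).
Proof. by elim: w => //= l w IH /andP[lg /IH h] /h; apply: gen_local. Qed.

Lemma act_restr g w z : word_le g w -> restr (Some g) (word_act w (restr (Some g)
    z)) = restr (Some g) (word_act w z).
Proof. by move=> gw; apply: act_local; rewrite // restr_restr ?lele_refl. Qed.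

Lemma act_cat w w' z : word_act (w ++ w') z = word_act w (word_act w' z).
Proof. exact: foldr_cat. Qed.

Lemma coherent_gen c e g b z : c <= g -> coherent_side g b z ->
    coherent_side g b (gen_act c e z).
Proof.
move=> cg h n; rewrite {1}/gen_act /below /= ltNge cg /= h word_codeK; last first.
  by rewrite /word_le /= cg; apply: word_enum_le.
by rewrite winv_cons act_cat /= negbK.
Qed.

Lemma coherent_act g b w z : word_le g w -> coherent_side g b z ->
    coherent_side g b (word_act w z).
Proof. by elim: w => //= l w IH /andP[lg /IH h] /h; apply: coherent_gen. Qed.

Lemma coherent_local g c b z y : g < c -> restr (Some c) z = restr (Some c) y ->
  coherent_side g b z -> coherent_side g b y.
Proof.
move=> gc E h n; move/restr_eqP: (E) => /(_ (Some g, n)) <- //; rewrite h.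
congr (sided _ _ _); apply: act_local; first by rewrite word_le_inv;
    apply: word_enum_le.
by apply: restr_eq E; apply: ltW.
Qed.

Lemma coherent_below_local c z y : restr (Some c) z = restr (Some c) y ->
    coherent_below c z -> coherent_below c y.
Proof. by move=> E h g gc; have [b hb] := h g gc; exists b;
    apply: (coherent_local gc E hb). Qed.

Lemma coherent_restr c z : coherent_below c (restr (Some c) z) <-> coherent_below c z.
Proof. by split; apply: coherent_below_local; rewrite restr_restr ?lele_refl. Qed.

Lemma level_restr c z : coherent_below c z -> level c (restr (Some c) z).
Proof. by move=> h; split; [rewrite restr_restr ?lele_refl|apply/coherent_restr]. Qed.

Lemma coherent_below_le b c z : b <= c -> coherent_below c z -> coherent_below b z.
Proof. by move=> bc h g gb; apply: h; apply: lt_le_trans bc. Qed.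

(** The action keeps the side bit, and block [g] is determined by this bit and the projection to
    [g]; so fixing the projection to [c] propagates upwards by induction. This lifts relations and
    freeness to later levels. *)
Lemma act_id_up c c' w z : word_le c w -> c <= c' -> coherent_below c' z ->
  restr (Some c) (word_act w z) = restr (Some c) z -> restr (Some c')
      (word_act w z) = restr (Some c') z.
Proof.
move=> cw cc' Zz E.
suff H' g : g <= c' -> restr (Some g) (word_act w z) = restr (Some g) z by apply: H'.
elim/(ltW_ind hW): g => g IH gc'.
apply/restr_eqP => -[[g'|] n] bi; last by move/restr_eqP: E; apply.
rewrite /below /= in bi.
have [g'c|cg'] := ltP g' c; first by move/restr_eqP: E; apply.
have [b hb] := Zz g' (lt_le_trans bi gc').
have hb' := coherent_act (word_le_le cg' cw) hb.
rewrite hb' hb; congr (sided _ _ _); apply: act_local.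
  by rewrite word_le_inv; apply: word_enum_le.
by apply: IH => //; apply: le_trans (ltW bi) gc'.
Qed.

Definition homeo_word w := forall l, l \in w -> homeo_at l.1.

Lemma homeo_word_cons l w : homeo_word (l :: w) -> homeo_at l.1 /\ homeo_word w.
Proof.
by move=> h; split=> [|k kw]; apply: h; rewrite inE ?eqxx // kw orbT.
Qed.

Lemma homeo_word_inv w : homeo_word w -> homeo_word (word_inv w).
Proof.
by move=> h l; rewrite /word_inv mem_rev => /mapP[k /h hk ->].
Qed.

Lemma restr_gen c e z : homeo_at c -> coherent_below c z -> restr (Some c)
    (gen_act c e z) = stage_map (H c) e (restr (Some c) z).
Proof.
move=> /(_ e)[hX _ _] Zz; have [<- _] := hX _ (level_restr Zz).
by apply/restr_eqP => i bi; rewrite /gen_act bi.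
Qed.

Lemma gen_coherent c e c' z : homeo_at c -> c <= c' -> coherent_below c' z ->
    coherent_below c' (gen_act c e z).
Proof.
move=> hc cc' Zz g gc'.
have [cg|gc] := leP c g.
  by have [b hb] := Zz g gc'; exists b; apply: coherent_gen.
have Zc := coherent_below_le cc' Zz.
have : coherent_below c (gen_act c e z).
  apply/coherent_restr; rewrite restr_gen //; have [hX _ _] := hc e.
  by have [] := hX _ (level_restr Zc).
exact.
Qed.

Lemma act_coherent c w z : homeo_word w -> word_le c w -> coherent_below c z ->
    coherent_below c (word_act w z).
Proof.
elim: w => //= l w IH /homeo_word_cons[hl hw] /andP[lc cw] Zz.
by apply: gen_coherent => //; apply: IH.
Qed.

Lemma genK c e c' z : homeo_at c -> c <= c' -> coherent_below c' z ->
  restr (Some c') (gen_act c (~~ e) (gen_act c e z)) = restr (Some c') z.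
Proof.
move=> hc cc' Zz; apply: (@act_id_up c c' [:: (c, ~~ e); (c, e)]) => //.
  by rewrite /word_le /= lexx.
have Zc := coherent_below_le cc' Zz.
rewrite /= restr_gen ?restr_gen //; last exact: gen_coherent.
by have [_ -> //] := hc e; apply: level_restr.
Qed.

Lemma act_winv c w z : homeo_word w -> word_le c w -> coherent_below c z ->
  restr (Some c) (word_act (word_inv w) (word_act w z)) = restr (Some c) z.
Proof.
elim: w => //= l w IH hlw /andP[lc cw] Zz.
have [hl hw] := homeo_word_cons hlw.
rewrite winv_cons act_cat -[RHS]IH //=.
by apply: act_local; [rewrite word_le_inv|apply: genK => //; apply: act_coherent].
Qed.

Lemma gen_cont c e c' z i : homeo_at c -> c <= c' -> coherent_below c' z ->
    below (Some c') i ->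
  exists2 s, all (below (Some c')) s & forall y, coherent_below c' y -> agr s z y ->
    gen_act c e z i = gen_act c e y i.
Proof.
move=> hc cc' Zz bi; rewrite /gen_act; case: ifP => bc.
  have [_ _ /(_ _ i (level_restr (coherent_below_le cc' Zz)))[s hs]] := hc e.
  exists [seq i <- s | below (Some c) i].
    by apply/allP => j; rewrite mem_filter => /andP[+ _]; apply: below_le.
  move=> y Zy a; apply: hs; first exact/level_restr/(coherent_below_le cc').
  exact: agr_restr.
case: i bi bc => [[g|] n] //= bi bc.
by exists [:: (Some g, word_code g ((c, ~~ e) :: word_enum g n))] => [|y _ ->] //=;
    rewrite ?inE ?andbT.
Qed.

Lemma act_cont c w z s0 : homeo_word w -> word_le c w -> coherent_below c z ->
    all (below (Some c)) s0 ->
  exists2 s, all (below (Some c)) s & forall y, coherent_below c y -> agr s z y ->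
    agr s0 (word_act w z) (word_act w y).
Proof.
move=> hw cw Zz; elim: w hw cw s0 => [|[b e] w IH] /=.
  by move=> _ _ s0 hs0; exists s0.
move=> /homeo_word_cons[hb hw] /andP[bc cw] s0 hs0.
have [s1 hs1 h1] : exists2 s1, all (below (Some c)) s1 & forall y,
    coherent_below c y ->
    agr s1 (word_act w z) y -> agr s0 (gen_act b e (word_act w z)) (gen_act b e y).
  elim: s0 hs0 => [|i s0 IH0] /=; first by exists [::].
  move=> /andP[bi /IH0[s1 hs1 h1]].
  have [s2 hs2 h2] := gen_cont e hb bc (act_coherent hw cw Zz) bi.
  exists (s1 ++ s2); first by rewrite all_cat hs1.
  move=> y Zy /agr_cat[/(h1 _ Zy) a1 /(h2 _ Zy) a2] j.
  by rewrite inE => /predU1P[->|/a1].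
have [s hs h] := IH hw cw s1 hs1.
exists s => // y Zy a; apply: h1; first exact: act_coherent.
exact: h.
Qed.

Lemma sided_off g b y : y <> split_pt (H g) -> sided g b y = split_side (H g) y.
Proof. by rewrite /sided; case: asboolP. Qed.

Lemma sided_on g b : sided g b (split_pt (H g)) = b.
Proof. by rewrite /sided; case: asboolP. Qed.

(** The blocks are filled in recursively, with the side [true] throughout. *)
Lemma base_ext (a : pt) : exists z, (forall g, coherent g z) /\
    restr None z = restr None a.
Proof.
pose asm (h : W -> nat -> bool) : pt :=
  fun i => if i is (Some g, n) then h g n else a i.
have [||h stage_map] := @W_rec _ W hW (nat -> bool) (fun=> false) (fun g h =>
    forall n,
  h g n = sided g true (restr (Some g) (word_act (word_inv (word_enum g n))
      (asm h)))).
- move=> g h h' E hP n; rewrite -E // hP; congr (sided _ _ _); apply: act_local.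
    by rewrite word_le_inv; apply: word_enum_le.
  by apply/restr_eqP => -[[g'|] m] //= bi; rewrite E //; apply: ltW.
- move=> g h _; exists (fun n => sided g true (restr (Some g)
    (word_act (word_inv (word_enum g n)) (asm h)))).
  move=> n; rewrite eqxx; congr (sided _ _ _); apply: act_local.
    by rewrite word_le_inv; apply: word_enum_le.
  by apply/restr_eqP => -[[g'|] m] //= bi; rewrite lt_eqF.
exists (asm h); split=> [g|]; first by exists true => n; apply: stage_map.
by apply/restr_eqP => -[[]].
Qed.

(** Isolates the topmost block of a basic neighbourhood, for the induction in [star]. *)
Lemma top_block c o (s : seq idx) : all (below (Some c)) s -> lev_le o (Some c) ->
  all (below o) s \/ exists g, [/\ g < c, lev_le o (Some g) &
    forall i, i \in s -> below (Some g) i \/ i.1 = Some g].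
Proof.
move=> + oc; elim: s => [|i s IH] /=; first by left.
move=> /andP[ic /IH[so|[g [gc og hs]]]].
  case oi: (below o i); first by left.
  case: i ic oi => [[b|] n]; last by case: (o).
  move=> bc /negbT/notbelow ob; right; exists b; split=> // j.
  rewrite inE => /predU1P[->|js]; first by right.
  by left; apply: below_le ob _; apply: (allP so).
right; case: i ic => [[b|] n] bc; last first.
  by exists g; split=> // j; rewrite inE => /predU1P[->|/hs //]; left.
have [bg|gb] := leP b g.
  exists g; split=> // j; rewrite inE => /predU1P[->|/hs //].
  by move: bg; rewrite le_eqVlt => /predU1P[->|]; [right|left].
exists b; split=> [//||j]; first by case: (o) og => //= o' /le_trans; apply;
    apply: ltW.
rewrite inE => /predU1P[->|/hs[h|h]]; [by right| |].
  by left; apply: below_le h; apply: ltW.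
by left; case: j h => [[g'|] m] //= [->].
Qed.

Lemma homeo_word_le c w : (forall g, g <= c -> good_stage g) -> word_le c w ->
    homeo_word w.
Proof. by move=> h /allP cw l /cw /h[]. Qed.

Lemma off_split c w y : (forall g, g <= c -> good_stage g) -> word_le c w ->
    coherent_below c y ->
  restr (Some c) (word_act w y) <> split_pt (H c) ->
  exists2 s, all (below (Some c)) s & forall z, coherent_below c z -> agr s y z ->
    restr (Some c) (word_act w z) <> split_pt (H c) /\
    split_side (H c) (restr (Some c) (word_act w z)) = split_side (H c)
        (restr (Some c) (word_act w y)).
Proof.
move=> G cw Zy ne; have hw := homeo_word_le G cw.
have [_ _ [[Xx _] _] [cf _] _] := G c (lexx c).
have [s1 h1] := cf _ (level_restr (act_coherent hw cw Zy)) ne.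
have [i ni] : exists i, restr (Some c) (word_act w y) i <> split_pt (H c) i.
  by apply/existsNP => h; apply: ne; apply: funext.
have bi : below (Some c) i.
  by apply: contrapT => /negP/negbTE bi; apply: ni; rewrite -Xx /restr bi.
have [|s hs h] := act_cont (s0 := i :: [seq i <- s1 | below (Some c) i]) hw cw Zy.
  by rewrite /= bi filter_all.
exists s => // z Zz /(h _ Zz) a; split.
  by move=> E; apply: ni; rewrite -E !restrE // a // inE eqxx.
apply: h1; first exact/level_restr/act_coherent.
by apply: agr_restr => j js; apply: a; rewrite inE js orbT.
Qed.

(** [w] after the inverse of [w0] fixes the split point, hence everything by freeness: up to its
    action, only one word takes [y] to the split point. *)
Lemma on_split c w w0 y z : (forall g, g <= c -> good_stage g) -> word_le c w ->
    word_le c w0 ->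
  coherent_below c y -> restr (Some c) (word_act w y) = split_pt (H c) ->
      restr (Some c) (word_act w0 y) = split_pt (H c) ->
  coherent_below c z -> restr (Some c) (word_act w z) = restr (Some c)
      (word_act w0 z).
Proof.
move=> G cw cw0 Zy E E0 Zz; have hw := homeo_word_le G cw; have hw0 :=
    homeo_word_le G cw0.
have [_ fr [Xx _] _ _] := G c (lexx c).
have cu : word_le c (w ++ word_inv w0) by rewrite word_le_cat cw word_le_inv.
have K v : coherent_below c v -> restr (Some c) (word_act (w ++ word_inv w0)
    (restr (Some c) (word_act w0 v))) = restr (Some c) (word_act w v).
  move=> Zv; rewrite act_restr // act_cat; apply: act_local => //.
  exact: act_winv.
rewrite -(K z Zz) (fr _ cu) //; last exact/level_restr/act_coherent.
by exists (split_pt (H c)) => //; rewrite -{1}E0 K.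
Qed.

(* Near [y], membership in a basic neighbourhood involving the block [c] is
   decided by the coordinates below [c], once the side of the split is right. *)
Lemma block_nbhd c b y s : (forall g, g <= c -> good_stage g) ->
    coherent_below c y -> coherent_side c b y ->
  (forall i, i \in s -> below (Some c) i \/ i.1 = Some c) ->
  exists2 s1, all (below (Some c)) s1 & forall z, coherent_below c z ->
      coherent c z -> agr s1 y z ->
    (forall w, word_le c w -> restr (Some c) (word_act w y) = split_pt (H c) ->
      restr (Some c) (word_act w z) <> split_pt (H c) /\ split_side (H c)
          (restr (Some c) (word_act w z)) = b) ->
    agr s y z.
Proof.
move=> G Zy hb; elim: s => [|i s IH] hs; first by exists [::].
have [|s1 hs1 h1] := IH; first by move=> j js; apply: hs; rewrite inE js orbT.
suff [s2 hs2 h2] : exists2 s2, all (below (Some c)) s2 & forall z,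
    coherent_below c z -> coherent c z ->
    agr s2 y z -> (forall w, word_le c w -> restr (Some c) (word_act w y)
        = split_pt (H c) ->
      restr (Some c) (word_act w z) <> split_pt (H c) /\ split_side (H c)
          (restr (Some c) (word_act w z)) = b) ->
    y i = z i.
  exists (s2 ++ s1); first by rewrite all_cat hs2.
  move=> z Zz cz /agr_cat[a2 a1] k j; rewrite inE => /predU1P[->|]; first exact: h2.
  exact: h1.
have [bi|ic] := hs i (mem_head _ _).
  by exists [:: i] => [|z _ _ a _]; rewrite /= ?bi // a // inE.
case: i ic {hs IH} => [o n] /= ->.
have cw : word_le c (word_inv (word_enum c n)) by rewrite word_le_inv;
    apply: word_enum_le.
have [E|ne] := pselect (restr (Some c) (word_act (word_inv (word_enum c n)) y)
    = split_pt (H c)).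
  exists [::] => // z Zz [b' hb'] _ /(_ _ cw E)[ne eb].
  by rewrite hb hb' E sided_on sided_off.
have [s2 hs2 h2] := off_split G cw Zy ne.
exists s2 => // z Zz [b' hb'] /(h2 _ Zz)[ne' e'] _.
by rewrite hb hb' !sided_off.
Qed.

(* The later splittings keep the promise made for [promised o]. *)
Lemma star c o y : (forall g, g < c -> good_stage g) -> lev_le o (Some c) ->
    coherent_below c y ->
  accum_pt (promised o) (restr o y) -> forall s, all (below (Some c)) s ->
  exists2 a, promised o a & a <> restr o y /\ forall z, coherent_below c z ->
      restr o z = a -> agr s z y.
Proof.
elim/(ltW_ind hW): c y => c IH y G oc Zy dy s sc.
have [so|[g [gc og hs]]] := top_block sc oc.
  have [a Fa [na aa]] := dy s; exists a => //; split=> // z Zz E.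
  by apply: (agr_restrW so); rewrite E.
have Gg g' : g' <= g -> good_stage g' by move=> le; apply: G;
    apply: le_lt_trans le gc.
have Zgy := coherent_below_le (ltW gc) Zy.
have [b hb] := Zy g gc.
have [s1 hs1 h1] := block_nbhd Gg Zgy hb hs.
have [[w0 cw0 E0]|no] :=
    pselect (exists2 w, word_le g w & restr (Some g) (word_act w y)
        = split_pt (H g)); last first.
  (* Off the split orbit, block [g] is decided near [y] by coordinates below [g], so the promise at
     the smaller level [g] suffices. *)
  have [a Fa [na aa]] := IH g gc y (fun g' lt => Gg g' (ltW lt)) og Zgy dy s1 hs1.
  exists a => //; split=> // z Zz E; apply/agr_sym/h1.
  - exact: coherent_below_le (ltW gc) Zz.
  - exact: Zz.
  - by apply/agr_sym/aa => //; apply: coherent_below_le (ltW gc) Zz.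
  - by move=> w cw Ew; case: no; exists w.
have hw0 := homeo_word_le Gg cw0.
have [_ _ [[Xx Zx] _] [_ sp] _] := Gg g (lexx g).
have cw0' : word_le g (word_inv w0) by rewrite word_le_inv.
have hw0' := homeo_word_inv hw0.
have yx : restr (Some g) y = restr (Some g) (word_act (word_inv w0) (split_pt (H g))).
  rewrite -E0 act_restr // act_winv //.
have [s2 hs2 h2] := act_cont hw0' cw0' Zx hs1.
(* Here [y] projects to the split point moved by the inverse of [w0] and lies on its side [b], so
   fibres on that side are requested. *)
have [|a Fa [na ha]] := sp o (word_inv w0) og cw0' _ b s2 hs2.
  by rewrite -(restr_eq og yx).
exists a; rewrite // (restr_eq og yx); split=> // z Zz E.
have Zgz := coherent_below_le (ltW gc) Zz.
pose x := restr (Some g) (word_act w0 z).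
have Xx' : level g x by apply/level_restr/act_coherent.
have xz : restr (Some g) (word_act (word_inv w0) x) = restr (Some g)
    z by rewrite act_restr // act_winv.
have [|ax fx] := ha _ Xx'; first by rewrite (restr_eq og xz).
have nx : x <> split_pt (H g).
  by move=> xE; apply: na; rewrite -E -(restr_eq og xz) xE.
apply/agr_sym/h1 => //; first exact: Zz.
  apply: (agr_restr_eq hs1 (esym yx)); apply/agr_sym.
  apply: (agr_restr_eq hs1 xz); apply/agr_sym.
  by apply: h2; [case: Xx'|apply: agr_sym].
move=> w cw Ew; rewrite (on_split Gg cw cw0 Zgy Ew E0 Zgz).
by split.
Qed.

Lemma fresh_base (s : seq idx) : exists n, (None, n) \notin s.
Proof.
exists (\max_(i <- s) i.2).+1; apply/negP => h.
have := leq_bigmax_seq (P := xpredT) (F := snd) _ h isT.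
by rewrite /= ltnn.
Qed.

Lemma der_base y : accum_pt (promised None) (restr None y).
Proof.
move=> s; have [n hn] := fresh_base s.
exists (fun i => if i == (None, n) then ~~ restr None y i else restr None y i).
  by apply: funext => -[[g|] m].
split=> [/(congr1 (@^~ (None, n)))|i si]; first by rewrite eqxx; case: (restr _ _ _).
by case: eqP => // E; move: hn; rewrite -E si.
Qed.

(** The promise at level [None] puts near [y] the whole fibre over another initial point, and
    [base_ext] shows that this fibre is non-empty. *)
Lemma level_perfect c y s : (forall g, g < c -> good_stage g) -> level c y ->
  exists z, [/\ level c z, z <> y & agr s z y].
Proof.
move=> G Xy; have [Ey Zy] := Xy.
have := @star c None y G isT Zy (der_base y) [seq i <- s | below (Some c)
    i] (filter_all _ _).
move=> [a Fa [na h]].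
have [z [cz Ez]] := base_ext a.
have Zz : coherent_below c z by move=> g _.
exists (restr (Some c) z); split; first exact: level_restr.
  by move=> E; apply: na; rewrite -E restr_restr // Ez Fa.
by rewrite -Ey; apply: agr_restr; apply: h; rewrite // Ez.
Qed.

(** Off the split orbit, continuity of the split function decides the block. On it, any two
    coordinates showing the side bit are equal, because they are equal in a nearby coherent
    point. *)
Lemma coherent_closed c z0 : (forall g, g < c -> good_stage g) ->
  (forall s, exists2 z, coherent_below c z & agr s z0 z) -> coherent_below c z0.
Proof.
move=> G lim g; elim/(ltW_ind hW): g => g IH gc.
have Zz0 : coherent_below g z0 by move=> g' lt; apply: IH => //;
    apply: lt_trans lt gc.
have Gg g' : g' <= g -> good_stage g' by move=> le; apply: G;
    apply: le_lt_trans le gc.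
have off n : restr (Some g) (word_act (word_inv (word_enum g n)) z0)
    <> split_pt (H g) ->
    z0 (Some g, n) = split_side (H g) (restr (Some g)
        (word_act (word_inv (word_enum g n)) z0)).
  have cw : word_le g (word_inv (word_enum g n)) by rewrite word_le_inv;
      apply: word_enum_le.
  move=> ne; have [s hs h] := off_split Gg cw Zz0 ne.
  have [z Zz a] := lim ((Some g, n) :: s).
  have [||ne' <-] := h z; first exact: coherent_below_le (ltW gc) Zz.
    by move=> i si; apply: a; rewrite inE si orbT.
  have [b hb] := Zz g gc.
  by rewrite a ?mem_head // hb sided_off.
have [[w0 cw0 E0]|no] :=
    pselect (exists2 w, word_le g w & restr (Some g) (word_act w z0)
        = split_pt (H g)); last first.
  exists true => n; rewrite sided_off ?off //;
    by move=> E; apply: no; exists (word_inv (word_enum g n));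
        rewrite // word_le_inv; apply: word_enum_le.
have En0 : word_inv (word_enum g (word_code g (word_inv w0)))
    = w0 by rewrite word_codeK ?winvK // word_le_inv.
exists (z0 (Some g, word_code g (word_inv w0))) => n.
have cw : word_le g (word_inv (word_enum g n)) by rewrite word_le_inv;
    apply: word_enum_le.
have [E|ne] := pselect (restr (Some g) (word_act (word_inv (word_enum g n)) z0)
    = split_pt (H g)); last first.
  by rewrite sided_off ?off.
rewrite E sided_on.
have [z Zz a] := lim [:: (Some g, n); (Some g, word_code g (word_inv w0))].
have [b hb] := Zz g gc.
rewrite !a ?inE ?eqxx ?orbT // !hb En0.
by rewrite (on_split Gg cw cw0 Zz0 E E0) //; apply: coherent_below_le (ltW gc) Zz.
Qed.

(** A finite word with letters below [c] has a bound [b < c]; freeness holds there and [act_id_up]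
    lifts it. *)
Lemma free_below c w : (forall g, g < c -> good_stage g) -> all (fun l => l.1 < c)
    w ->
  (exists2 z, level c z & restr (Some c) (word_act w z) = z) ->
  forall z, level c z -> restr (Some c) (word_act w z) = z.
Proof.
move=> G wc [z0 Xz0 E0] z [Ez Zz].
have [->|[b [bc bw]]] : w = [::] \/ exists b, b < c /\ word_le b w.
- elim: w wc {E0} => [|[g e] w IH] /=; first by left.
  move=> /andP[gc /IH[->|[b [bc bw]]]]; right.
    by exists g; rewrite /word_le /= lexx.
  have [gb|bg] := leP g b; first by exists b; rewrite /word_le /= gb.
  exists g; split=> //; rewrite /word_le /= lexx; exact: word_le_le (ltW bg) bw.
- by rewrite /=.
have [_ fr _ _ _] := G b bc; have [Ez0 Zz0] := Xz0.
rewrite -[RHS]Ez; apply: (act_id_up bw (ltW bc) Zz).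
have := fr w bw _ (restr (Some b) z); rewrite act_restr // => -> //.
  exists (restr (Some b) z0); first exact/level_restr/(coherent_below_le (ltW bc)).
  by rewrite act_restr // -[in RHS]E0 restr_restr //= ltW.
exact/level_restr/(coherent_below_le (ltW bc)).
Qed.

End History.

(** * Locality: a stage depends only on the history up to it *)

Lemma gen_ext H H' c : stage_map (H c) = stage_map (H' c) ->
    gen_act H c = gen_act H' c.
Proof. by rewrite /gen_act => ->. Qed.

Lemma act_ext H H' w : (forall l, l \in w -> stage_map (H l.1)
    = stage_map (H' l.1)) ->
  word_act H w = word_act H' w.
Proof.
move=> h; apply: funext => z; elim: w h => //= l w IH h.
rewrite IH => [|k kw]; last by apply: h; rewrite inE kw orbT.
by rewrite (gen_ext (h l _)) // mem_head.
Qed.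

Lemma act_ext_le H H' c w : (forall g, g <= c -> H g = H' g) -> word_le c w ->
  word_act H w = word_act H' w.
Proof. by move=> h /allP cw; apply: act_ext => l /cw /h ->. Qed.

Lemma level_ext H H' c : (forall g, g < c -> H g = H' g) -> level H c = level H' c.
Proof.
suff K H1 H2 : (forall g, g < c -> H1 g = H2 g) -> forall z, level H1 c z ->
    level H2 c z.
  move=> h; apply: funext => z; apply: propext; split; apply: K => // g lt.
  by rewrite h.
move=> h z [Ez Zz]; split=> // g gc; have [b hb] := Zz g gc; exists b => n.
rewrite hb /sided h // (@act_ext_le H1 H2 g) // => [g' g'g|].
  by apply: h; apply: le_lt_trans gc.
by rewrite word_le_inv; apply: word_enum_le.
Qed.

Lemma good_stage_ext H H' c : (forall g, g <= c -> H g = H' g) -> good_stage H c ->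
    good_stage H' c.
Proof.
move=> h; have XE : level H c = level H' c by apply: level_ext => g /ltW /h.
have AE w : word_le c w -> word_act H w = word_act H' w by apply: act_ext_le.
have HE := h c (lexx c).
move=> [g1 g2 [g3 g4] [g5 g6] g7]; split.
- by rewrite /homeo_at /level_cont -XE -HE.
- by move=> w cw; rewrite -XE -AE //; apply: g2.
- by rewrite -XE -HE /aims -XE.
- rewrite -HE; split; first by rewrite /cont_off -XE.
  by move=> o w oc cw; rewrite -AE // -XE; apply: g6.
- by rewrite /task -XE -HE.
Qed.

(** * Charts identifying each level with the Cantor set *)

Definition code c z : nat -> bool := fun m => z (coord c m).

Lemma coord_cover c (s : seq idx) : all (below (Some c)) s ->
  exists k, forall z y, agree k (code c z) (code c y) -> agr s z y.
Proof.
elim: s => [|i s IH] /=; first by exists 0%N.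
move=> /andP[/coord_surj[m <-] /IH[k hk]]; exists (maxn m.+1 k) => z y a j.
rewrite inE => /predU1P[->|]; first by apply: (a m); rewrite leq_max leqnn.
by apply: hk; apply: agree_le a; rewrite leq_maxr.
Qed.

Lemma agr_code c k z y : agr [seq coord c m | m <- iota 0 k] z y ->
  agree k (code c z) (code c y).
Proof.
by move=> h m mk; apply: h; apply: map_f; rewrite mem_iota.
Qed.

Lemma code_inj H c z y : level H c z -> level H c y -> code c z = code c y -> z = y.
Proof.
move=> [<- _] [<- _] E; apply/restr_eqP => i /coord_surj[m <-].
by have := congr1 (@^~ m) E; rewrite /code !restrE //; apply: coord_below.
Qed.

Section Stage.
Variables (H : W -> data) (c : W).
Hypothesis G : forall g, g < c -> good_stage H g.

Lemma level_nonempty : exists z, level H c z.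
Proof.
have [z [cz _]] := base_ext H (fun=> false).
by exists (restr (Some c) z); apply: level_restr => g _.
Qed.

Definition is_chart (Phi : pt -> nat -> bool) (Theta : (nat -> bool) -> pt) :=
  [/\ forall y, level H c (Theta y), cancel Theta Phi,
      forall z, level H c z -> Theta (Phi z) = z,
      forall y s, exists n, forall y', agree n y y' -> agr s (Theta y) (Theta y') &
      forall z k, level H c z -> exists s, forall z', level H c z' -> agr s z z' ->
        agree k (Phi z) (Phi z')].

Lemma chart_exists : exists Phi Theta, is_chart Phi Theta.
Proof.
have /choice[jx hjx] i : exists m, below (Some c) i -> coord c m = i.
  by case bi: (below (Some c) i); [have [m] := coord_surj bi; exists m|exists 0%N].
pose lift (x : nat -> bool) : pt := fun i => below (Some c) i && x (jx i).
have liftK z : level H c z -> lift (code c z) = z.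
  move=> [Ez _]; rewrite -[RHS]Ez; apply: funext => i; rewrite /lift /restr /code.
  by case bi: (below (Some c) i) => //=; rewrite hjx.
have lift_cont x s : exists n, forall x', agree n x x' -> agr s (lift x) (lift x').
  elim: s => [|i s [n hn]]; first by exists 0%N.
  exists (maxn (jx i).+1 n) => x' a j; rewrite inE => /predU1P[->|].
    by rewrite /lift; congr (_ && _); apply: a; rewrite leq_max leqnn.
  by apply: hn; apply: agree_le a; rewrite leq_maxr.
pose P x := exists2 z, level H c z & x = code c z.
have [|||f [g [gP gc gK fK fc]]] := @brouwer P.
- move=> x lim.
  (* [coord c] may list a coordinate repeatedly, so a limit of codes has to be consistent on the
     repetitions. *)
  have xE m : x m = x (jx (coord c m)).
    have [y [z Xz ->] a] := lim (maxn m.+1 (jx (coord c m)).+1).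
    rewrite !a /code ?hjx ?coord_below //; by rewrite leq_max leqnn ?orbT.
  exists (lift x); last by apply: funext => m; rewrite /code /lift coord_below.
  split; first by apply: funext => i; rewrite /restr /lift; case: (below _ _).
  apply: coherent_closed => // s; have [n hn] := lift_cont x s.
  have [y [z Xz ->] a] := lim n; exists z; first by case: Xz.
  by rewrite -[z in agr _ _ z]liftK //; apply: hn.
- move=> x n [z Xz ->].
  have [y [Xy ny a]] := level_perfect [seq coord c m | m <- iota 0 n] G Xz.
  exists (code c y); split; [by exists y|exact: (agr_code (agr_sym a))|].
  by move/(code_inj Xy Xz).
- by have [z Xz] := level_nonempty; exists (code c z), z.
have gE y : exists2 z, level H c z & g y = code c z by have := gP y.
exists (fun z => f (code c z)), (fun y => lift (g y)); split.
- by move=> y; have [z Xz ->] := gE y; rewrite liftK.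
- by move=> y; have [z Xz E] := gE y; rewrite E liftK // -E gK.
- by move=> z Xz; rewrite fK ?liftK //; exists z.
- move=> y s; have [n hn] := lift_cont (g y) s; have [m hm] := gc y n.
  by exists m => y' /hm /hn.
- move=> z k Xz; have [|n hn] := fc (code c z) k; first by exists z.
  exists [seq coord c m | m <- iota 0 n] => z' Xz' a.
  by apply: hn; [exists z'|apply: agr_code].
Qed.

Section WithChart.
Variables (Phi : pt -> nat -> bool) (Theta : (nat -> bool) -> pt).
Hypothesis ch : is_chart Phi Theta.

Lemma level_cont_agr f z s : level_cont H c f -> level H c z ->
  exists s', forall y, level H c y -> agr s' z y -> agr s (f z) (f y).
Proof.
move=> cf Xz; elim: s => [|i s [s' hs]]; first by exists [::].
have [s2 h2] := cf z i Xz; exists (s2 ++ s') => y Xy /agr_cat[a2 a'] j.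
by rewrite inE => /predU1P[->|]; [exact: h2|exact: hs].
Qed.

Lemma conj_cont f : (forall z, level H c z -> level H c (f z)) -> level_cont H c f ->
  cont (fun y => Phi (f (Theta y))).
Proof.
have [tX tK pK tc pc] := ch.
move=> fX cf y k; have [s hs] := pc _ k (fX _ (tX y)).
have [s' hs'] := level_cont_agr s cf (tX y); have [n hn] := tc y s'.
by exists n => y' /hn a; apply: hs; [exact/fX/tX|apply: hs'].
Qed.

Lemma conj_homeo f f' :
  (forall z, level H c z -> level H c (f z)) -> (forall z, level H c z ->
      level H c (f' z)) ->
  level_cont H c f -> level_cont H c f' ->
  (forall z, level H c z -> f' (f z) = z) -> (forall z, level H c z -> f (f' z)
      = z) ->
  exists h : homeo, forall y, h y = Phi (f (Theta y)).
Proof.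
have [tX tK pK tc pc] := ch.
move=> fX fX' cf cf' K K'.
have k1 : cancel (fun y => Phi (f (Theta y))) (fun y => Phi (f' (Theta y))).
  by move=> y; rewrite /= pK ?K ?tK //; apply: fX.
have k2 : cancel (fun y => Phi (f' (Theta y))) (fun y => Phi (f (Theta y))).
  by move=> y; rewrite /= pK ?K' ?tK //; apply: fX'.
by exists (Homeo (conj_cont fX cf) (conj_cont fX' cf') k1 k2).
Qed.

Lemma conj_level_cont (h : homeo) : level_cont H c (fun z => Theta (h (Phi z))).
Proof.
have [tX tK pK tc pc] := ch.
move=> z i Xz; have [n hn] := tc (h (Phi z)) [:: i].
have [m hm] := hf_cont h (Phi z) n; have [s hs] := pc z m Xz.
by exists s => y Xy a; apply: (hn (h (Phi y))); [apply/hm/hs|rewrite inE].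
Qed.

(** A clopen condition reads finitely many bits, so every [g] near [g0] performs the task too, which
    leaves room for genericity. An inapplicable task is met by any map. *)
Lemma task_homeo : exists (g0 : homeo) m, forall g : homeo, near m g0 g ->
  forall a u v, task_at c = (a, (u, v)) -> a <= c ->
  (exists2 z, level H c z & matches a u z) -> (exists2 z, level H c z &
      ~~ matches a u z) ->
  (exists2 z, level H c z & matches a v z) -> (exists2 z, level H c z &
      ~~ matches a v z) ->
  forall y, matches a v (Theta (g y)) = matches a u (Theta y).
Proof.
have [tX tK pK tc pc] := ch.
case E: (task_at c) => [a [u v]].
have lc u' : loc_const (fun y => matches a u' (Theta y)).
  move=> y; have [s _ hs] := matches_loc a u' (Theta y); have [n hn] := tc y s.
  by exists n => y' /hn /hs.
have val u' b : (exists2 z, level H c z & matches a u' z) -> (exists2 z,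
    level H c z & ~~ matches a u' z) ->
    exists y, matches a u' (Theta y) = b.
  move=> [z Xz uz] [z' Xz' uz'].
  exists (Phi (if b then z else z')); rewrite pK; last by case: b.
  by case: b => //; apply/negbTE.
have [[ac u1 u2 v1 v2]|nv] := pselect [/\ a <= c,
    exists2 z, level H c z & matches a u z, exists2 z, level H c z & ~~ matches a u z,
    exists2 z, level H c z & matches a v z & exists2 z, level H c z &
        ~~ matches a v z]; last first.
  by exists hid, 0%N => g _ a' u' v' [<- <- <-] ? ? ? ? ?; case: nv; split.
have [|g0 hg0] := @label_homeo bool _ _ (lc u) (lc v).
  by move=> b; split=> _; apply: val.
have [||n hn] := fan (P := fun n y => forall y', agree n y y' ->
    matches a v (Theta y) = matches a v (Theta y')).
- by move=> i j y ij h y' ayy'; apply: h; apply: agree_le ayy'.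
- move=> y; have [n hn] := lc v y; exists n => y' ay y'' ay'.
  by rewrite -hn // -hn //; apply: agree_trans ay'.
exists g0, n => g gg a' u' v' [<- <- <-] _ _ _ _ _ y.
by rewrite -hg0; apply/esym/hn; have [] := gg y.
Qed.

End WithChart.

(** * Construction of one stage *)

Lemma act_lt_props w : all (fun l => l.1 < c) w ->
  [/\ word_le c w, homeo_word H w, forall z, level H c z ->
      level H c (restr (Some c) (word_act H w z)),
      level_cont H c (fun z => restr (Some c) (word_act H w z)) &
      forall z, level H c z -> restr (Some c) (word_act H (word_inv w)
          (restr (Some c) (word_act H w z))) = z].
Proof.
move=> wc; have cw : word_le c w by apply: sub_all wc => l /ltW.
have hw : homeo_word H w by move=> l lw; have [] := G (allP wc l lw).
split=> //.
- by move=> z [_ Zz]; apply/level_restr/act_coherent.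
- move=> z i [_ Zz]; case bi: (below (Some c) i); last first.
    by exists [::] => y _ _; rewrite /restr bi.
  have [|s _ hs] := act_cont (s0 := [:: i]) hw cw Zz; first by rewrite /= bi.
  exists s => y [_ Zy] a; rewrite !restrE //; apply: hs => //; by rewrite inE.
- move=> z [Ez Zz]; rewrite act_restr ?word_le_inv // act_winv //.
Qed.

Definition upd_at (x : data) : W -> data := fun b => if b == c then x else H b.

Lemma upd_below x g : g < c -> H g = upd_at x g.
Proof. by rewrite /upd_at => /lt_eqF ->. Qed.

(** A chart carries the countable action of the words with letters below [c] to the Cantor set,
    where [free_extension] adds a generator near one performing the task. The split data of [x] stay
    arbitrary because they are chosen afterwards. *)
Lemma stage_homeo : exists h, forall x, stage_map x = h ->
  [/\ homeo_at (upd_at x) c, free (upd_at x) c & task (upd_at x) c].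
Proof.
have [Phi [Theta ch]] := chart_exists; have [tX tK pK tc pc] := ch.
pose E n : word := [seq l <- word_enum c n | l.1 < c].
have Elt n : all (fun l => l.1 < c) (E n) by apply: filter_all.
have Esurj w : all (fun l => l.1 < c) w -> exists n, E n = w.
  move=> wc; have cw : word_le c w by apply: sub_all wc => l /ltW.
  have [n En_] := word_enum_surj cw; exists n; rewrite /E En_.
  by apply/all_filterP.
have /choice[Gh hG] n : exists h : homeo, forall y,
    h y = Phi (restr (Some c) (word_act H (E n) (Theta y))).
  have inv_lt : all (fun l => l.1 < c) (word_inv (E n)).
    by rewrite /word_inv all_rev all_map; apply: Elt.
  have [cw hw p1 p2 p3] := act_lt_props (Elt n).
  have [_ _ p1' p2' p3'] := act_lt_props inv_lt.
  apply: (conj_homeo ch p1 p1' p2 p2' p3) => z Xz.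
  by have := p3' z Xz; rewrite winvK.
have ThG n y : Theta (Gh n y) = restr (Some c) (word_act H (E n) (Theta y)).
  by rewrite hG pK //; have [_ _ p _ _] := act_lt_props (Elt n); apply: p.
have [g0 [m hg0]] := task_homeo ch.
have [|||g near_g gfree] := @free_extension Gh _ _ _ g0 m.
- move=> i j; have [|k hk] := Esurj (E i ++ E j); first by rewrite all_cat !Elt.
  exists k => y; rewrite hG hk act_cat hG ThG act_restr //.
  by have [] := act_lt_props (Elt i).
- have [//|k hk] := Esurj [::]; exists k => y; rewrite hG hk /=.
  by have [-> _] := tX y; rewrite tK.
- move=> n [y0 fy0] y.
  have fr := free_below G (Elt n); rewrite -[RHS]tK hG; congr (Phi _).
  by apply: fr => //; exists (Theta y0); rewrite // -ThG fy0.
exists (fun e z => Theta (hpow g e (Phi z))) => x hx.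
have XE : level H c = level (upd_at x) c by apply: level_ext; apply: upd_below.
have HE : stage_map (upd_at x c) = fun e z => Theta (hpow g e (Phi z)).
  by rewrite /upd_at eqxx.
have hax : homeo_at (upd_at x) c.
  move=> e; rewrite HE -XE; split=> [z _|z Xz|]; first exact: tX.
    by rewrite /= tK hpowK pK.
  by move=> z i; rewrite -XE; apply: (conj_level_cont ch).
have [w1 w2] : (forall y, coherent_below (upd_at x) c (Theta y)) /\ (forall y,
    restr (Some c) (Theta y) = Theta y).
  by split=> y; have := tX y; [rewrite XE|]; case.
have words w : word_le c w -> exists q : seq (nat + bool), forall y,
    restr (Some c) (word_act (upd_at x) w (Theta y)) = Theta (wev Gh g q y).
  elim: w => [_|[b e] w IH] /=; first by exists [::].
  move=> /andP[]; rewrite le_eqVlt => /predU1P[->|bc] /IH[q hq].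
    exists (inr e :: q) => y; rewrite (@gen_local _ c c e _ (Theta (wev Gh g q y)))
        //.
      by rewrite restr_gen // w2 HE tK.
    by rewrite hq w2.
  have [|n hn] := Esurj [:: (b, e)]; first by rewrite /= bc.
  exists (inl n :: q) => y; rewrite (@gen_local _ b c e _ (Theta (wev Gh g q y)))
      ?ltW //.
    by rewrite ThG hn /= (@gen_ext _ H) // -upd_below.
  by rewrite hq w2.
split=> //.
- move=> w /words[q hq] [z0]; rewrite -XE => Xz0; rewrite -(pK z0 Xz0) hq => E0 z Xz.
  rewrite -(pK z Xz) hq; congr Theta; apply: gfree; exists (Phi z0).
  by have := congr1 Phi E0; rewrite !tK.
- move=> a u v tE ac; rewrite -XE => u1 u2 v1 v2 z Xz.
  by rewrite HE (hg0 g near_g _ _ _ tE) // pK.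
Qed.

(** The countably many pairs of a level [o] and a word [w] number the families for [split_fun];
    their members are fibres found by [star] near [w x0] and moved back to [x0]. *)
Lemma stage_split x0 : homeo_at H c -> level H c x0 ->
  exists f, cont_off H c x0 f /\ splits H c x0 f.
Proof.
move=> hc Xx; have [Ex Zx] := Xx.
have whc w : word_le c w -> homeo_word H w.
  move=> /allP cw l /cw; rewrite le_eqVlt => /predU1P[->//|/G[]//].
pose lv k := if k is k'.+1 then Some (en c k') else None.
have lv_le k : lev_le (lv k) (Some c) by case: k => //= k; apply: en_le.
pose decode m : nat * nat := odflt (0, 0)%N (unpickle m).
pose A m phi := let o := lv (decode m).1 in let w := word_enum c (decode m).2 in
  accum_pt (promised o) (restr o (word_act H w x0)) -> exists2 a, promised o a &
      a <> restr o (word_act H w x0) /\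
    phi = [set code c z | z in [set z | level H c z /\ restr o (word_act H w z) = a]].
have [|f [f1 f2]] := @split_fun (code c x0) A.
  move=> m k; set o := lv (decode m).1; set w := word_enum c (decode m).2.
  have cw : word_le c w by apply: word_enum_le.
  have hw := whc w cw; have hw' := homeo_word_inv hw.
  have cw' : word_le c (word_inv w) by rewrite word_le_inv.
  have [dx|ndx] := pselect (accum_pt (promised o) (restr o (word_act H w x0)));
      last first.
    (* Where the projection of [w x0] is no accumulation point nothing is promised, and the empty
       set serves. *)
    by exists set0; [move=> dx; case: (ndx dx)|split=> //; exists 0%N].
  have Zwx := act_coherent hw cw Zx.
  pose s0 := [seq coord c m | m <- iota 0 k].
  have bs0 : all (below (Some c)) s0 by apply/allP => _ /mapP[j _ ->];
      apply: coord_below.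
  have [s bs hs] := act_cont hw' cw' Zwx bs0.
  have [a Fa [na ha]] := star G (lv_le _) Zwx dx bs.
  exists [set code c z | z in [set z | level H c z /\ restr o (word_act H w z) = a]].
    by move=> _; exists a.
  split.
    move=> _ [z [[Ez Zz] Ea] <-]; apply: agr_code.
    have Zwz := act_coherent hw cw Zz.
    have := hs _ Zwz (agr_sym (ha _ Zwz Ea)) => h.
    apply: (agr_restr_eq bs0 (act_winv hw cw Zx)); apply/agr_sym.
    by apply: (agr_restr_eq bs0 (act_winv hw cw Zz)); apply/agr_sym.
  have [[z1 Ea1]|ne] := pselect (exists z, restr o (word_act H w z) = a); last first.
    by exists 0%N => y [z [_ Ea] _]; case: ne; exists z.
  (* A coordinate at which [a] differs from the projection of [w x0] keeps the fibre away from
     [x0]. *)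
  have [i ni] : exists i, a i <> restr o (word_act H w x0) i.
    by apply/existsNP => h; apply: na; apply: funext.
  have bi : below o i.
    by apply: contrapT => /negP/negbTE bi; apply: ni; rewrite -Ea1 /restr bi.
  have [|s1 bs1 hs1] := act_cont (s0 := [:: i]) hw cw Zx.
    by rewrite /= (below_le (lv_le _) bi).
  have [k' hk'] := coord_cover bs1.
  exists k' => _ [z [[_ Zz] Ea] <-] /hk'/(hs1 _ Zz) /(_ i (mem_head _ _)) E.
  by apply: ni; rewrite -Ea !restrE.
exists (fun z => f (code c z)); split.
  move=> z Xz nz; have [|k hk] := f1 (code c z).
    by move/(code_inj Xz Xx).
  exists [seq coord c m | m <- iota 0 k] => y _ a; apply: hk; exact: agr_code.
move=> o w oc cw dx e s bs.
have [k0 ok] : exists k, lv k = o.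
  case: (o) oc => [b|]; last by exists 0%N.
  by move=> /en_surj[k <-]; exists k.+1.
have [n nw] := word_enum_surj cw.
have [k hk] := coord_cover bs.
have [phi] := f2 (pickle (k0, n)) e k.
rewrite /A /decode pickleK /= ok nw => /(_ dx)[a Fa [na ->]] hphi.
exists a => //; split=> // z Xz Ea.
have [|ak fe] := hphi (code c z); first by exists z.
by split=> //; apply/agr_sym/hk.
Qed.

End Stage.

Lemma stage_exists H c : (forall g, g < c -> good_stage H g) ->
  exists x, good_stage (upd_at H c x) c.
Proof.
move=> G; have [h hh_] := stage_homeo G.
have [x0 [Xx0 ax0]] : exists x0, level H c x0 /\ aims H c x0.
  have [[z Xz dz]|nz] := pselect (exists2 z, level H c z & accum_pt (guesses c) z).
    by exists z; split.
  by have [z Xz] := level_nonempty H c; exists z; split=> // h'; case: nz.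
pose D0 := Data x0 (fun=> false) h.
have [ha0 _ _] := hh_ D0 erefl.
have XE x : level H c = level (upd_at H c x) c by apply: level_ext; apply: upd_below.
have G0 g : g < c -> good_stage (upd_at H c D0) g.
  move=> gc; apply: good_stage_ext (G g gc) => g' g'g; apply: upd_below.
  exact: le_lt_trans gc.
have Xx0' : level (upd_at H c D0) c x0 by rewrite -XE.
have [f [f1 f2]] := stage_split G0 ha0 Xx0'.
pose D1 := Data x0 f h; exists D1.
have [ha1 fr1 ta1] := hh_ D1 erefl.
have AE w : word_act (upd_at H c D0) w = word_act (upd_at H c D1) w.
  by apply: act_ext => l _; rewrite /upd_at; case: eqP.
have XE01 : level (upd_at H c D0) c = level (upd_at H c D1) c by rewrite -!XE.
have E1 : upd_at H c D1 c = D1 by rewrite /upd_at eqxx.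
split=> //; rewrite E1 /=.
- by rewrite -XE /aims -XE.
- split; first by rewrite /cont_off -XE01.
  by move=> o w oc cw; rewrite -AE -XE01; apply: f2.
Qed.

Lemma system_exists : exists H, forall c, good_stage H c.
Proof.
apply: (@W_rec _ W hW data (Data (fun=> false) (fun=> false) (fun _ => id))).
  by move=> c H H' E; apply: good_stage_ext.
by move=> c H; apply: stage_exists.
Qed.

End System.

(** * The limit *)

Section Limit.
Local Open Scope order_scope.
Context {d : Order.disp_t} (W : orderType d).
Hypothesis hW : is_omega1 W.
Variable en : W -> nat -> W.
Hypothesis en_le : forall c n, en c n <= c.
Hypothesis en_surj : forall c b, b <= c -> exists n, en c n = b.
Variable e : W -> nat -> W.
Hypothesis e_inj : forall a m b n, e a m = e b n -> a = b /\ m = n.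
Variable D : W -> set W.
Hypothesis D_guess : forall A : set W,
  stationary [set a | A `&` [set b | b < a] = D a].

Notation idx := (option W * nat)%type.
Notation pt := (option W * nat -> bool).
Implicit Types (a c : W) (i : idx) (z y : pt).

(* [D c] is read as the code of a map from the predecessors of [c] to points,
   and, when it is the singleton of a code, as a task. *)
Definition decode c x : pt := fun i => below (Some c) i &&
  `[< exists b m1 m2, [/\ b < c, en b m1 = x, coord en b m2 = i &
      D c (e b (pickle (m1, m2)))] >].

Definition guess c : set pt := [set decode c x | x in [set x | x < c]].

Definition is_task c (t : W * (pattern * pattern)) := D c = [set e t.1 (pickle t.2)].

Definition taskof c : W * (pattern * pattern) :=
  if pselect (exists t, is_task c t) is left h then projT1 (cid h)
  else (c, ([::], [::])).

Lemma taskofE c t : is_task c t -> taskof c = t.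
Proof.
move=> ct; rewrite /taskof; case: pselect => [h|[]]; last by exists t.
case: cid => -[a p] /= h'; have : D c (e a (pickle p)) by rewrite h'.
rewrite ct => /e_inj[/= -> /(pcan_inj pickleK) ->].
by case: (t).
Qed.

Variable H : W -> data W.
Hypothesis HG : forall c, good_stage en guess taskof H c.

Definition limit_set : set pt := [set z | forall g, coherent en H g z].

Lemma limit_coherent c z : limit_set z -> coherent_below en H c z. Proof. by move=>
    h g _. Qed.

Lemma limit_level c z : limit_set z -> level en H c (restr (Some c) z).
Proof. by move=> /(limit_coherent (c := c)) h; apply: level_restr. Qed.

Lemma lt_next a : exists b, a < b.
Proof. by have [b hb] := range_bounded hW (fun=> a); exists b; apply: (hb 0%N). Qed.

Lemma above (s : seq idx) a : exists2 c, a <= c & all (below (Some c)) s.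
Proof.
elim: s => [|[[b|] n] s [c ac hs]]; [by exists a| |by exists c; rewrite //= hs].
have [c' cc'] := lt_next (Order.max b c); rewrite gt_max in cc'.
have /andP[bc' cc''] := cc'.
exists c'; first exact: le_trans ac (ltW cc'').
rewrite /= {1}/below /= bc' /=; apply: sub_all hs => i; apply: below_le.
exact: ltW.
Qed.

Lemma limit_setP z : (forall c, coherent_below en H c z) -> limit_set z.
Proof. by move=> h g; have [c gc] := lt_next g; apply: (h c). Qed.

Lemma limit_set_closed z0 : (forall s, exists2 z, limit_set z & agr s z0 z) ->
    limit_set z0.
Proof.
move=> lim; apply: limit_setP => c;
    refine (coherent_closed hW en_le en_surj (fun g _ => HG g) _) => s.
by have [z Xz a] := lim s; exists z => //; apply: limit_coherent.
Qed.

Lemma limit_set_base (a : pt) : exists2 z, limit_set z & forall n, z (None, n)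
    = a (None, n).
Proof.
have [z [cz /restr_eqP E]] := base_ext hW en_le H a; exists z => // n.
exact: E.
Qed.

Lemma limit_set_perfect z s : limit_set z -> exists y, [/\ limit_set y, y <> z &
    agr s z y].
Proof.
move=> Xz; have [a0 _] := W_inhabited hW; have [c _ sc] := above s a0.
have := @star _ W hW en en_le en_surj guess taskof H c None z (fun g _ => HG g) isT
  (limit_coherent Xz) (der_base guess z) s sc.
move=> [a Fa [na h]]; have [y Xy Ey] := limit_set_base a.
have Ea : restr None y = a.
  by rewrite -[RHS]Fa; apply/restr_eqP => -[[b|] n] //.
exists y; split=> //; first by move=> E; apply: na; rewrite -Ea E.
by apply/agr_sym/h => //; apply: limit_coherent.
Qed.

(** Diamond is applied to a set coding the graph of [p]. At a [c] closed under [f], the coding map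
    [e] and the choice [s] of larger elements, the codes below [c] determine the projections of all
    [p x] with [x < c]. *)
Lemma reflect_guess (p : W -> pt) (f : W -> nat -> W) a0 : exists c,
  [/\ a0 < c, forall b, b < c -> forall n, f b n < c &
      guess c = [set restr (Some c) (p x) | x in [set x | x < c]]].
Proof.
pose A : set W := [set x | exists b m1 m2,
  x = e b (pickle (m1, m2)) /\ p (en b m1) (coord en b m2)].
have /choice[s hs] := lt_next.
pose F b n := Order.max (f b n) (Order.max (e b n) (s b)).
have [c [/= Dc [a0c hc]]] := D_guess A (club_closed hW F a0).
have {}hc b n : b < c -> [/\ f b n < c, e b n < c & s b < c].
  by move=> /hc /(_ n); rewrite /F !gt_max => /and3P[].
exists c; split=> // [b bc n|]; first by have [] := hc b n bc.
suff E x : x < c -> decode c x = restr (Some c) (p x).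
  by apply/seteqP; split=> _ [x xc <-]; exists x; rewrite ?E.
move=> xc; apply: funext => i; rewrite /decode /restr.
case bi: (below (Some c) i) => //=; apply/asboolP/idP.
  move=> [b [m1 [m2 [bc <- <-]]]]; rewrite -Dc => -[[b' [m1' [m2' [E h]]]] _].
  by have [-> /(pcan_inj pickleK)[-> ->]] := e_inj E.
move=> hpi.
have [b [bc xb ib]] : exists b, [/\ b < c, x <= b & below (Some b) i].
  case: i bi {hpi} => [[g|] n] gc; last by exists x.
  exists (s (Order.max x g)).
  have [|_ _ h] := hc (Order.max x g) 0%N; first by rewrite gt_max xc.
  have := hs (Order.max x g); rewrite gt_max => /andP[/ltW h1 h2].
  by split.
have [m1 E1] := en_surj xb; have [m2 E2] := coord_surj en_surj ib.
exists b, m1, m2; split=> //; rewrite -Dc; split; last by have [] :=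
    hc b (pickle (m1, m2)) bc.
by exists b, m1, m2; rewrite E1 E2.
Qed.

Lemma below_limit c (s : seq idx) a0 : a0 < c ->
  (forall b, b < c -> exists2 b', b < b' & b' < c) ->
  all (below (Some c)) s -> exists2 b, b < c & all (below (Some b)) s.
Proof.
move=> a0c lim; elim: s => [|[[g|] n] s IH] /=; first by exists a0.
  move=> /andP[gc /IH[b bc bs]].
  have [|b' lt b'c] := lim (Order.max g b); first by rewrite gt_max bc andbT.
  move: lt; rewrite gt_max => /andP[gb' bb']; exists b' => //.
  rewrite {1}/below /= gb' /=; apply: sub_all bs => i; apply: below_le; exact: ltW.
by move=> /IH[b bc bs]; exists b.
Qed.

(** * Hereditary separability *)

Definition matches_below b (q : seq (nat * bool)) z := all (fun t =>
    z (coord en b t.1) == t.2) q.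

Lemma match_agr b s y : all (below (Some b)) s ->
  exists q, forall z, matches_below b q z <-> agr s y z.
Proof.
elim: s => [|i s IH] /=; first by exists [::].
move=> /andP[/(coord_surj en_surj)[m <-] /IH[q hq]].
exists ((m, y (coord en b m)) :: q) => z /=; split.
  by move=> /andP[/eqP E /hq a] j; rewrite inE => /predU1P[->|/a].
move=> a; apply/andP; split; first by rewrite a ?mem_head.
by apply/hq => j js; apply: a; rewrite inE js orbT.
Qed.

Lemma no_left_separated (p : W -> pt) : (forall x, limit_set (p x)) ->
  (forall c, exists s, forall a, a < c -> ~ agr s (p c) (p a)) -> False.
Proof.
move=> pX ls.
have [w0 _] := W_inhabited hW.
have /choice[f1 hf1] (t : W * seq (nat * bool)) : exists x,
    (exists x, matches_below t.1 t.2 (p x)) -> matches_below t.1 t.2 (p x).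
  have [[y h]|nh] := pselect (exists x, matches_below t.1 t.2 (p x));
      first by exists y.
  by exists w0.
pose Q (t : W * seq (nat * bool)) (v : W * W * W) :=
  [/\ matches_below t.1 t.2 (p v.1.1), matches_below t.1 t.2 (p v.1.2) &
      exists2 i, below (Some v.2) i & p v.1.1 i <> p v.1.2 i].
(* Accumulation asks for a projection other than that of [p c]: of two points in a neighbourhood
   with distinct projections, one qualifies. [f2] yields such a pair with a level separating it. *)
have /choice[f2 hf2] (t : W * seq (nat * bool)) : exists v,
    (exists x x', [/\ matches_below t.1 t.2 (p x), matches_below t.1 t.2 (p x') &
        p x <> p x']) -> Q t v.
  have [[x [y [mx my ne]]]|nh] := pselect (exists x x',
    [/\ matches_below t.1 t.2 (p x), matches_below t.1 t.2 (p x') & p x <> p x']);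
        last first.
    by exists (w0, w0, w0) => h; case: nh.
  have [i ni] : exists i, p x i <> p y i by apply/existsNP => h; apply: ne;
      apply: funext.
  have [c _ /andP[ic _]] := above [:: i] w0.
  by exists (x, y, c) => _; split=> //; exists i.
have /choice[s hs] := lt_next.
pose f b n := if (unpickle n : option (seq (nat * bool))) is Some q then
  Order.max (Order.max (f1 (b, q)) (s b))
    (Order.max (f2 (b, q)).1.1 (Order.max (f2 (b, q)).1.2 (f2 (b, q)).2)) else w0.
have [c [w0c hc gc]] := reflect_guess p f w0.
have {}hc b q : b < c -> [/\ f1 (b, q) < c, s b < c, (f2 (b, q)).1.1 < c,
    (f2 (b, q)).1.2 < c & (f2 (b, q)).2 < c].
  move=> bc; have := hc b bc (pickle q); rewrite /f pickleK !gt_max.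
  by move=> /andP[/andP[? ?] /and3P[? ? ?]].
have lim b : b < c -> exists2 b', b < b' & b' < c.
  by move=> bc; exists (s b); [exact: hs|have [] := hc b [::] bc].
have dy : accum_pt (guess c) (restr (Some c) (p c)).
  move=> s0; have [b bc bs] := below_limit w0c lim (filter_all (below (Some c)) s0).
  have [q hq] := match_agr (p c) bs.
  have [h1 _ h2 h3 h4] := hc b q bc.
  have m1 : matches_below b q (p (f1 (b, q))) by apply: (hf1 (b, q)); exists c;
      apply/hq.
  have [|m2 m3 [i bi ni]] := hf2 (b, q).
    exists c, (f1 (b, q)); split=> //; first exact/hq.
    by have [s1 hs1] := ls c; move=> E; apply: (hs1 _ h1); rewrite -E.
  have ci : below (Some c) i by apply: below_le bi; apply: ltW.
  have fin x : x < c -> matches_below b q (p x) -> restr (Some c) (p x)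
      <> restr (Some c) (p c) ->
      exists2 a, guess c a & a <> restr (Some c) (p c) /\ agr s0 a (restr (Some c)
          (p c)).
    move=> xc mx ne; exists (restr (Some c) (p x)); first by rewrite gc; exists x.
    by split=> //; apply/agr_restr/agr_sym/hq.
  have [E|ne] := pselect (restr (Some c) (p (f2 (b, q)).1.1) = restr (Some c) (p c)).
    apply: fin h3 m3 _ => E'; apply: ni.
    by move: E; rewrite -E' => /restr_eqP; apply.
  exact: fin h2 m2 ne.
have [s0 hs0] := ls c; have [c' cc' s0c'] := above s0 c.
(* The promise puts the whole fibre over an earlier projection into the neighbourhood [s0], and with
   it an earlier [p x]. *)
have := @star _ W hW en en_le en_surj guess taskof H c' (Some c) (p c)
  (fun g _ => HG g) cc' (limit_coherent (pX c)) dy s0 s0c'.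
move=> [a + [_ ha]]; rewrite /= gc => -[x xc Ea].
by apply: (hs0 x xc); apply/agr_sym/ha; rewrite ?Ea //; apply: limit_coherent.
Qed.

Lemma limit_set_hereditarily_separable (A : set pt) : A `<=` limit_set ->
  exists E, [/\ countable E, E `<=` A &
    forall y, A y -> forall s, exists2 z, E z & agr s y z].
Proof.
move=> AX; apply: contrapT => nsep.
have [p hp] : exists p : W -> pt, forall x, A (p x) /\
    exists s, forall a, a < x -> ~ agr s (p x) (p a); last first.
  apply: (no_left_separated (p := p)) => x; first by apply: AX; have [] := hp x.
  by have [] := hp x.
apply: (@W_rec _ W hW pt (fun=> false)).
  move=> c p p' E [h1 [s hs]]; rewrite -E //; split=> //.
  by exists s => y yc; rewrite -E ?ltW //; apply: hs.
move=> c p hp; pose E := p @` [set b | b < c].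
have cE : countable E by apply: countable_image; have [_ _] := hW; apply.
have [y [Ay [s hs]]] : exists y, A y /\ exists s, forall z, E z -> ~ agr s y z.
  apply: contrapT => h; apply: nsep; exists E; split=> //.
    by move=> _ [b /hp[]] ? _ <-.
  move=> y Ay s; apply: contrapT => h'; apply: h; exists y; split=> //.
  by exists s => z Ez a; apply: h'; exists z.
exists y; rewrite eqxx; split=> //; exists s => b bc; rewrite lt_eqF //.
by apply: hs; exists b.
Qed.

Lemma limit_set_sequence (u : nat -> pt) x : (forall n, limit_set (u n)) ->
    limit_set x ->
  (forall s, exists N, forall n, (N <= n)%N -> agr s x (u n)) ->
  exists N, forall n, (N <= n)%N -> u n = x.
Proof.
move=> uX xX cv; apply: contrapT => /forallNP nc.
have [w0 _] := W_inhabited hW.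
have /choice[v hv] N : exists t : nat * W, (N <= t.1)%N /\
    exists2 i, below (Some t.2) i & u t.1 i <> x i.
  have /existsNP[n /not_implyP[Nn ne]] := nc N.
  have [i ni] : exists i, u n i <> x i by apply/existsNP => h; apply: ne;
      apply: funext.
  have [c _ /andP[ic _]] := above [:: i] w0.
  by exists (n, c); split=> //; exists i.
(* Above [a1] the chosen terms that differ from [x] still do so after projection; above [a2] all
   codes of the sequence are present. *)
have [a1 ha1] := range_bounded hW (fun n => (v n).2).
have [a2 ha2] := range_bounded hW (e w0).
(* The sequence is spread over [W] along [e w0]; the default [u 0] adds nothing to its range. *)
pose p b := if pselect (exists k, e w0 k = b) is left h then u (projT1 (cid h))
    else u 0%N.
have pe k : p (e w0 k) = u k.
  rewrite /p; case: pselect => [h|[]]; last by exists k.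
  by case: cid => k' /= /e_inj[_ ->].
have pu b : exists k, p b = u k.
  by rewrite /p; case: pselect => [h|_]; [exists (projT1 (cid h))|exists 0%N].
have [c [ac _ gc]] := reflect_guess p (fun _ _ => w0) (Order.max a1 a2).
move: ac; rewrite gt_max => /andP[a1c a2c].
have gE y : guess c y <-> exists n, y = restr (Some c) (u n).
  rewrite gc; split=> [[b bc <-]|[n ->]]; first by have [k ->] := pu b; exists k.
  by exists (e w0 n); rewrite ?pe //=; apply: lt_trans (ha2 n) a2c.
have far N : exists2 n, (N <= n)%N & restr (Some c) (u n) <> restr (Some c) x.
  have [Nn [i bi ni]] := hv N; exists (v N).1 => // /restr_eqP E; apply: ni; apply: E.
  by apply: below_le bi; apply/ltW/(lt_trans (ha1 N)).
have dx : accum_pt (guess c) (restr (Some c) x).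
  move=> s; have [N hN] := cv s; have [n Nn ne] := far N.
  exists (restr (Some c) (u n)); first by apply/gE; exists n.
  split=> //; apply/agr_restr/agr_sym => i; rewrite mem_filter => /andP[_].
  exact: (hN n).
have [_ _ [[Ex Zx] aim] [_ spl] _] := HG c.
have {}aim : accum_pt (guess c) (split_pt (H c)).
  by apply: aim; exists (restr (Some c) x) => //; apply: limit_level.
have avoid y N : restr (Some c) y = y -> exists2 s, all (below (Some c)) s &
    forall n, (n < N)%N -> restr (Some c) (u n) <> y -> ~ agr s (restr (Some c)
        (u n)) y.
  move=> Ey; elim: N => [|N [s hs h]]; first by exists [::].
  have [E|ne] := pselect (restr (Some c) (u N) = y).
    by exists s => // n; rewrite ltnS leq_eqVlt => /predU1P[->|] //; apply: h.
  have [i ni] : exists i, restr (Some c) (u N) i <> y i.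
    by apply/existsNP => h'; apply: ne; apply: funext.
  have bi : below (Some c) i.
    by apply: contrapT => /negP/negbTE bi; apply: ni; rewrite -Ey /restr bi.
  exists (i :: s); first by rewrite /= bi.
  move=> n; rewrite ltnS leq_eqVlt => /predU1P[->|lt] ne' a.
    by apply: ni; apply: a; rewrite mem_head.
  by apply: (h n lt ne') => j js; apply: a; rewrite inE js orbT.
(* A convergent sequence accumulates only at its limit. *)
have xxE : split_pt (H c) = restr (Some c) x.
  apply: contrapT => ne.
  have [i ni] : exists i, split_pt (H c) i <> restr (Some c) x i.
    by apply/existsNP => h'; apply: ne; apply: funext.
  have bi : below (Some c) i.
    by apply: contrapT => /negP/negbTE bi; apply: ni; rewrite -Ex /restr bi.
  have [N hN] := cv [:: i]; have [s _ hs] := avoid _ N Ex.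
  have [_ /gE[n ->] [na aa]] := aim (i :: s).
  have [lt|le] := ltnP n N.
    by apply: (hs n lt na) => j js; apply: aa; rewrite inE js orbT.
  apply: ni; rewrite -(aa i) ?mem_head // !restrE //.
  by rewrite -(hN n le) // inE.
have En0 : word_enum en c (word_code en c [::]) = [::] by rewrite word_codeK.
(* The coordinate of the empty word shows the side on which [x] lies. A term is requested on the
   other side, outside the finitely many exceptions below [N]. *)
set j := (Some c, word_code en c [::]).
have [N hN] := cv [:: j]; have [s bs hs] := avoid _ N Ex.
have [|_ /gE[n ->] [na ha]] := spl (Some c) [::] (lexx c) isT _ (~~ x j) s bs.
  by rewrite /= Ex.
have Xu := limit_level c (uX n).
have [|a fa] := ha _ Xu; first by rewrite /= restr_restr ?lele_refl.
rewrite /= Ex in na.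
have [lt|le] := ltnP n N; first by apply: (hs n lt na).
have [b hb] := uX n c.
have := hb (word_code en c [::]); rewrite En0 /= sided_off // fa -/j -(hN n le)
    ?inE //.
by case: (x j).
Qed.

(** * Homeomorphisms between clopen subsets of the limit *)

Definition cont_on (U : set pt) (f : pt -> pt) := forall z i, U z ->
  exists s, forall y, U y -> agr s z y -> f z i = f y i.

Definition set_homeo (U V : set pt) := exists f g : pt -> pt,
  [/\ (forall z, U z -> V (f z)) /\ (forall z, V z -> U (g z)),
      cont_on U f, cont_on V g,
      forall z, U z -> g (f z) = z & forall z, V z -> f (g z) = z].

Lemma set_homeo_id U : set_homeo U U.
Proof. by exists id, id; split=> // z i _; exists [:: i] => y _; apply;
    rewrite inE. Qed.

Lemma set_homeo_sym U V : set_homeo U V -> set_homeo V U.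
Proof. by move=> [f [g [[h1 h2] h3 h4 h5 h6]]]; exists g, f. Qed.

Lemma cont_on_agr U f z s : cont_on U f -> U z ->
  exists s', forall y, U y -> agr s' z y -> agr s (f z) (f y).
Proof.
move=> cf Uz; elim: s => [|i s [s' hs]]; first by exists [::].
have [s2 h2] := cf z i Uz; exists (s2 ++ s') => y Uy /agr_cat[a2 a'] j.
by rewrite inE => /predU1P[->|]; [exact: h2|exact: hs].
Qed.

Lemma cont_on_comp U V f g : (forall z, U z -> V (f z)) -> cont_on U f ->
    cont_on V g ->
  cont_on U (g \o f).
Proof.
move=> UV cf cg z i Uz; have [s hs] := cg (f z) i (UV z Uz).
have [s' hs'] := cont_on_agr s cf Uz.
by exists s' => y Uy a; apply: hs; [exact: UV|exact: hs'].
Qed.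

Lemma set_homeo_trans V U V' : set_homeo U V -> set_homeo V V' -> set_homeo U V'.
Proof.
move=> [f [g [[h1 h2] h3 h4 h5 h6]]] [f' [g' [[k1 k2] k3 k4 k5 k6]]].
exists (f' \o f), (g \o g'); split=> /=.
- by split=> z hz; [apply/k1/h1|apply/h2/k2].
- exact: (cont_on_comp h1).
- exact: (cont_on_comp k2).
- by move=> z hz; rewrite k5 ?h5 //; apply: h1.
- by move=> z hz; rewrite h6 ?k6 //; apply: k2.
Qed.

Definition fin_det (P : pt -> bool) := exists s, forall z y, agr s z y -> P z = P y.

Lemma cont_on_if U f f' (P : pt -> bool) : fin_det P ->
  cont_on [set z | U z /\ P z] f -> cont_on [set z | U z /\ ~~ P z] f' ->
  cont_on U (fun z => if P z then f z else f' z).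
Proof.
move=> [s hs] cf cf' z i Uz; case Pz: (P z).
  have [s' hs'] := cf z i (conj Uz Pz).
  exists (s ++ s') => y Uy /agr_cat[/hs E a]; rewrite -E Pz.
  by apply: hs' => //; split; rewrite -?E.
have [s' hs'] := cf' z i (conj Uz (negbT Pz)).
exists (s ++ s') => y Uy /agr_cat[/hs E a]; rewrite -E Pz.
by apply: hs' => //; split; rewrite -?E ?Pz.
Qed.

Lemma set_homeo_glue U V P Q : fin_det P -> fin_det Q ->
  set_homeo [set z | U z /\ P z] [set z | V z /\ Q z] ->
  set_homeo [set z | U z /\ ~~ P z] [set z | V z /\ ~~ Q z] -> set_homeo U V.
Proof.
move=> dP dQ [f [g [[h1 h2] h3 h4 h5 h6]]] [f' [g' [[k1 k2] k3 k4 k5 k6]]].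
exists (fun z => if P z then f z else f' z), (fun z => if Q z then g z else g' z).
split; try exact: cont_on_if.
- split=> z hz; case: ifPn => Pz.
  + by have [] := h1 z (conj hz Pz).
  + by have [] := k1 z (conj hz Pz).
  + by have [] := h2 z (conj hz Pz).
  + by have [] := k2 z (conj hz Pz).
- move=> z hz; case Pz: (P z).
    by have [_ ->] := h1 z (conj hz Pz); apply: h5.
  have [_ /negbTE ->] := k1 z (conj hz (negbT Pz)); apply: k5; split=> //.
  by rewrite Pz.
- move=> z hz; case Pz: (Q z).
    by have [_ ->] := h2 z (conj hz Pz); apply: h6.
  have [_ /negbTE ->] := k2 z (conj hz (negbT Pz)); apply: k6; split=> //.
  by rewrite Pz.
Qed.

Lemma pattern_of c s (P : pt -> bool) : all (below (Some c)) s ->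
  (forall z y, agr s z y -> P z = P y) -> exists u, forall z, matches en c u z = P z.
Proof.
elim: s P => [|i s IH] P /=.
  move=> _ hP; exists (if P (fun=> false) then [:: [::]] else [::]) => z.
  by rewrite (hP z (fun=> false)) //; case: ifP.
move=> /andP[/(coord_surj en_surj)[m <-] bs] hP.
pose set b z : pt := fun i => if i == coord en c m then b else z i.
have sub b : exists u, forall z, matches en c u z = P (set b z).
  apply: IH => // z y a; apply: hP => j; rewrite inE /set.
  by case: eqP => //= _ /a.
have [u1 hu1] := sub true; have [u0 hu0] := sub false.
have set_id z : set (z (coord en c m)) z = z.
  by apply: funext => j; rewrite /set; case: eqP => [->|].
have mtc b u z : matches en c [seq (m, b) :: p | p <- u] z = (z (coord en c m)
    == b) && matches en c u z.
  rewrite /matches has_map; elim: u => [|p u IHu] /=; first by rewrite andbF.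
  by rewrite IHu -andb_orr.
exists ([seq (m, true) :: p | p <- u1] ++ [seq (m, false) :: p | p <- u0]) => z.
rewrite /matches has_cat -!/(matches _ _ _ _) !mtc hu1 hu0 -{5}(set_id z).
by case: (z _) => /=; rewrite ?orbF.
Qed.

Lemma fin_detI P Q : fin_det P -> fin_det Q -> fin_det (fun z => P z && Q z).
Proof.
by move=> [s hs] [t ht]; exists (s ++ t) => z y /agr_cat[/hs -> /ht ->].
Qed.

Lemma fin_detN P : fin_det P -> fin_det (fun z => ~~ P z).
Proof. by move=> [s hs]; exists s => z y /hs ->. Qed.

Lemma fin_det_coord i : fin_det (fun z => z i).
Proof. by exists [:: i] => z y; apply; rewrite inE. Qed.

Definition part (P : pt -> bool) : set pt := [set z | limit_set z /\ P z].

(** Diamond at the singleton coding the task gives a stage performing it; its generator, lifted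
    through all later blocks, is the homeomorphism. *)
Lemma proper_homeo P Q : fin_det P -> fin_det Q ->
  part P !=set0 -> part (predC P) !=set0 ->
  part Q !=set0 -> part (predC Q) !=set0 -> set_homeo (part P) (part Q).
Proof.
move=> [s hs] [t ht] [z1 [X1 P1]] [z2 [X2 P2]] [z3 [X3 P3]] [z4 [X4 P4]].
have [a0 _] := W_inhabited hW.
have [a _] := above (s ++ t) a0; rewrite all_cat => /andP[sa ta].
have [u hu] := pattern_of sa hs; have [v hv] := pattern_of ta ht.
pose A := [set e a (pickle (u, v))].
have [c [/= Dc [ac hc]]] := D_guess A (club_closed hW e a).
have ct : is_task c (a, (u, v)).
  rewrite /is_task -Dc; apply/seteqP; split=> [y []//|y -> /=]; split=> //=.
  exact: hc.
have [ha _ _ _ tc] := HG c.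
have mE w z : matches en a w (restr (Some c) z) = matches en a w z.
  by apply: (@matches_restr _ _ en a c) (ltW ac) _; rewrite restr_restr ?lele_refl.
have {}tc z : level en H c z -> Q (stage_map (H c) true z) = P z.
  rewrite -hu -hv; move: z.
  by apply: (tc a u v (taskofE ct) (ltW ac)); [exists (restr (Some c) z1)
    |exists (restr (Some c) z2)|exists (restr (Some c) z3)|exists (restr (Some c)
        z4)];
    try (exact: limit_level); rewrite mE ?hu ?hv.
have gX b z : limit_set z -> limit_set (gen_act en H c b z).
  move=> Xz; apply: limit_setP => c'; have [c'' lt] := lt_next (Order.max c c').
  move: lt; rewrite gt_max => /andP[/ltW lt1 /ltW lt2].
  by apply: (coherent_below_le lt2); apply: gen_coherent => //; apply: limit_coherent.
have gK b z : limit_set z -> gen_act en H c (~~ b) (gen_act en H c b z) = z.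
  move=> Xz; apply: funext => i; have [c' cc' /andP[ic' _]] := above [:: i] c.
  have /restr_eqP := genK hW en_le en_surj b (ha) cc' (limit_coherent (c := c') Xz).
  by apply.
have gQ z : limit_set z -> Q (gen_act en H c true z) = P z.
  move=> Xz; rewrite -hv -mE (restr_gen en_le _ ha); last exact: limit_coherent.
  by rewrite hv tc; [rewrite -!hu mE|exact: limit_level].
have gP z : limit_set z -> P (gen_act en H c false z) = Q z.
  by move=> Xz; rewrite -(gQ _ (gX _ _ Xz)) -[true]/(~~ false) gK.
have gc b R : cont_on (part R) (gen_act en H c b).
  move=> z i [Xz _]; have [c' cc' /andP[ic' _]] := above [:: i] c.
  have [s' _ hs'] := gen_cont en_le b ha cc' (limit_coherent (c := c') Xz) ic'.
  by exists s' => y [Xy _]; apply: hs'; apply: limit_coherent.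
exists (gen_act en H c true), (gen_act en H c false); split=> //.
- by split=> z [Xz Pz]; split; rewrite ?gQ ?gP //; apply: gX.
- by move=> z [Xz _]; apply: (gK true).
- by move=> z [Xz _]; apply: (gK false).
Qed.

(** Tasks concern proper clopen sets only, so the whole space is cut: [P] goes onto one half of [P]
    and the complement of [P] onto the other, the halves being given by a coordinate that varies on
    [P]. *)
Lemma whole_homeo P : fin_det P -> part P !=set0 -> part (predC P) !=set0 ->
  set_homeo limit_set (part P).
Proof.
move=> dP nP nC; have [z [Xz Pz]] := nP; have [s hs] := dP.
have [y [Xy ne a]] := limit_set_perfect s Xz.
have [i ni] : exists i, y i <> z i by apply/existsNP => h; apply: ne; apply: funext.
have Py : P y by rewrite -(hs z).
have di := fin_det_coord i.
have sub (Q : pt -> bool) x : P x -> limit_set x -> Q x -> part (fun z => P z &&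
    Q z) !=set0.
  by move=> Px Xx Qx; exists x; split; rewrite ?Px.
have compl (Q : pt -> bool) : part (predC (fun z => P z && Q z)) !=set0.
  by have [x [Xx nPx]] := nC; exists x; split=> //=; rewrite negb_and (negbTE nPx).
have [n1 n2] : part (fun z => P z && z i) !=set0 /\ part (fun z => P z && ~~ z i)
    !=set0.
  case zi: (z i); case yi: (y i); move: ni; rewrite zi yi // => _.
    by split; [exact: sub zi|apply: (sub _ y); rewrite ?yi].
  by split; [exact: sub yi|apply: (sub _ z); rewrite ?zi].
have assoc (Q : pt -> bool) : [set z | part P z /\ Q z] = part (fun z => P z && Q z).
  by apply/seteqP; split=> x /=; rewrite /part /= => -[]; [move=> [? ->]|move=>
      ? /andP[]].
apply: (set_homeo_glue dP di); rewrite assoc.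
  by apply: proper_homeo => //; exact: fin_detI.
apply: proper_homeo => //; [exact: fin_detN|apply: fin_detI => //; exact: fin_detN|].
exists z; split=> //=; by rewrite Pz.
Qed.

Lemma limit_set_homogeneous P Q : fin_det P -> fin_det Q ->
  part P !=set0 -> part Q !=set0 -> set_homeo (part P) (part Q).
Proof.
suff H1 R : fin_det R -> part R !=set0 -> set_homeo limit_set (part R).
  move=> dP dQ nP nQ; apply: (set_homeo_trans (V := limit_set)); last exact: H1.
  by apply/set_homeo_sym/H1.
move=> dR nR; have [nC|nC] := pselect (part (predC R) !=set0);
    first exact: whole_homeo.
suff -> : part R = limit_set by apply: set_homeo_id.
apply/seteqP; split=> z; first by case.
by move=> Xz; split=> //; apply: contrapT => /negP nz; apply: nC; exists z.
Qed.

End Limit.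

(** * The cylinder topology *)

Section CylinderSpace.
Context {d : Order.disp_t} (W : orderType d).
Notation idx := (option W * nat)%type.
Notation pt := (option W * nat -> bool).
Variable S : set pt.

Definition cyl_space : Type := {z : pt | S z}.

Definition cyl_open (A : set cyl_space) := forall x, A x ->
  exists s, forall y, agr s (sval x) (sval y) -> A y.

Lemma cyl_openT : cyl_open setT.
Proof. by move=> x _; exists [::]. Qed.

Lemma cyl_openI : setI_closed cyl_open.
Proof.
move=> A B oA oB x [/oA[s hs] /oB[t ht]]; exists (s ++ t) => y /agr_cat[a b].
by split; [exact: hs|exact: ht].
Qed.

Lemma cyl_open_bigU (I : Type) (f : I -> set cyl_space) :
  (forall i, cyl_open (f i)) -> cyl_open (\bigcup_i f i).
Proof.
move=> of_ x [i _ /of_[s hs]]; exists s => y /hs fy; by exists i.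
Qed.

HB.instance Definition _ := gen_eqMixin cyl_space.
HB.instance Definition _ := gen_choiceMixin cyl_space.
HB.instance Definition _ :=
  isOpenTopological.Build cyl_space cyl_openT cyl_openI cyl_open_bigU.

Lemma cyl_nbhs (x : cyl_space) (A : set cyl_space) :
  nbhs x A <-> exists s, forall y, agr s (sval x) (sval y) -> A y.
Proof.
split.
  rewrite nbhsE => -[B [oB Bx] BA].
  have [s hs] := (oB : cyl_open B) x Bx; exists s => y /hs /BA //.
move=> [s hs]; rewrite nbhsE; exists [set y : cyl_space | agr s (sval x)
    (sval y)] => //.
split=> //; suff : cyl_open [set y : cyl_space | agr s (sval x) (sval y)] by [].
move=> y /= xy; exists s => z yz i si; by rewrite xy ?yz.
Qed.

Lemma sval_inj (x y : cyl_space) : sval x = sval y -> x = y.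
Proof.
by case: x y => [x Sx] [y Sy] /= E; move: Sx; rewrite E => Sx; congr exist.
Qed.

Lemma cyl_hausdorff : hausdorff_space cyl_space.
Proof.
move=> x y cl; apply: sval_inj; apply: funext => i.
have nb (z : cyl_space) : nbhs z [set t : cyl_space | sval z i = sval t i].
  by apply/cyl_nbhs; exists [:: i] => t; apply; rewrite inE.
by have [z [/= -> ->]] := cl _ _ (nb x) (nb y).
Qed.

Lemma cyl_clopen_base : has_clopen_base cyl_space.
Proof.
exists clopen => //; split=> [A []//|x A /cyl_nbhs[s hs]].
exists [set y : cyl_space | agr s (sval x) (sval y)]; last exact: hs.
split=> //; split.
  suff : cyl_open [set y : cyl_space | agr s (sval x) (sval y)] by [].
  by move=> y /= xy; exists s => z yz i si; rewrite xy ?yz.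
rewrite -openC.
suff : cyl_open (~` [set y : cyl_space | agr s (sval x) (sval y)]) by [].
by move=> y /= xy; exists s => z yz h; apply: xy => i si; rewrite h ?yz.
Qed.

(** The limit of an ultrafilter is read off coordinatewise, and closedness puts it into [S]. *)
Lemma cyl_compact : (forall z0, (forall s, exists2 z, S z & agr s z0 z) -> S z0) ->
  compact [set: cyl_space].
Proof.
move=> closedS; rewrite compact_ultra => F FU _.
pose z0 : pt := fun i => `[< F [set x : cyl_space | sval x i] >].
have Fi i : F [set x : cyl_space | z0 i = sval x i].
  rewrite /z0; case: asboolP => h.
    by apply: filterS h => x /= ->.
  have [//|] := in_ultra_setVsetC [set x : cyl_space | sval x i] FU.
  by apply: filterS => x /= /negP/negbTE ->.
have Fs s : F [set x : cyl_space | agr s z0 (sval x)].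
  elim: s => [|i s IH]; first by apply: filterS filterT.
  apply: filterS (filterI (Fi i) IH) => x [/= E a] j.
  by rewrite inE => /predU1P[->|/a].
have Sz0 : S z0.
  apply: closedS => s; have [x a] := filter_ex (Fs s).
  by exists (sval x) => //; apply: (svalP x).
exists (exist _ z0 Sz0); split=> // A /cyl_nbhs[s hs].
by apply: filterS (Fs s) => x /hs.
Qed.

Lemma cyl_clopen_det (U : set cyl_space) : compact [set: cyl_space] -> clopen U ->
  exists P : pt -> bool, fin_det P /\ forall x : cyl_space, U x <-> P (sval x).
Proof.
move=> /compact_near_coveringP cov [oU cU].
have oU' : cyl_open U by [].
have oC : cyl_open (~` U) by rewrite -openC in cU.
(* Along the filter of ever larger finite sets of coordinates, compactness makes the local
   dependence on finitely many coordinates uniform. *)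
pose F : set_system (seq idx) :=
  filter_from [set: seq idx] (fun s : seq idx => [set t : seq idx | {subset s <= t}]).
have FF : Filter F.
  apply: filter_from_filter; first by exists [::].
  move=> s t _ _; exists (s ++ t) => // v /= h.
  by split=> i hi; apply: h; rewrite mem_cat hi ?orbT.
have [|s0 _ hs0] := cov (seq idx) F
    (fun t x => forall y : cyl_space, agr t (sval x) (sval y) -> (U x <-> U y)) FF.
  move=> x _.
  have [s hs] : exists s, forall y : cyl_space, agr s (sval x) (sval y) -> (U x <->
      U y).
    have [Ux|nUx] := pselect (U x).
      by have [s hs] := oU' x Ux; exists s => y /hs.
    by have [s hs] := oC x nUx; exists s => y /hs.
  exists ([set y : cyl_space | agr s (sval x) (sval y)],
      [set t : seq idx | {subset s <= t}]).
    by split=> /=; [apply/cyl_nbhs; exists s|exists s].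
  move=> [x' t] /= [xx' st] y x'y.
  rewrite -(hs x') // -(hs y) // => i si.
  by rewrite xx' // x'y //; apply: st.
have h (x y : cyl_space) : agr s0 (sval x) (sval y) -> (U x <-> U y).
  by apply: hs0.
exists (fun z => `[< exists2 x : cyl_space, U x & agr s0 z (sval x) >]); split.
  exists s0 => z y a; apply/asboolP/asboolP => -[x Ux b]; exists x => // i si.
    by rewrite -a ?b.
  by rewrite a ?b.
move=> x; split=> [Ux|/asboolP[y Uy a]]; first by apply/asboolP; exists x.
exact/(h x y).
Qed.

Lemma cyl_sub_nbhs (U : set cyl_space) (x : U) (A : set U) :
  nbhs x A <-> exists s, forall y : U, agr s (sval (val x)) (sval (val y)) -> A y.
Proof.
split.
  rewrite nbhsE => -[B [[C oC <-] Cx] BA].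
  have [s hs] := (oC : cyl_open C) _ Cx; exists s => y /hs /BA //.
move=> [s hs]; rewrite nbhsE.
exists (set_val @^-1` [set y : cyl_space | agr s (sval (val x)) (sval y)]) => //.
split=> //; exists [set y : cyl_space | agr s (sval (val x)) (sval y)] => //.
suff : cyl_open [set y : cyl_space | agr s (sval (val x)) (sval y)] by [].
by move=> y /= xy; exists s => z yz i si; rewrite xy ?yz.
Qed.

Lemma cyl_homeomorphic (U V : set cyl_space) :
  set_homeo [set sval x | x in U] [set sval x | x in V] -> homeomorphic U V.
Proof.
have lift (A B : set cyl_space) (f : pt -> pt) :
    (forall z, [set sval x | x in A] z -> [set sval x | x in B] (f z)) ->
    exists F : A -> B, forall x, sval (val (F x)) = f (sval (val x)).
  move=> AB.
  have /choice[F hF] (x : A) : exists y : B, sval (val y) = f (sval (val x)).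
    have [|y By E] := AB (sval (val x)); first by exists (val x) => //;
        apply: set_valP.
    by exists (SigSub (mem_set By)).
  by exists F.
have cont (A B : set cyl_space) (f : pt -> pt) (F : A -> B) :
    cont_on [set sval x | x in A] f ->
    (forall x, sval (val (F x)) = f (sval (val x))) -> continuous F.
  move=> cf hF x N /cyl_sub_nbhs[s hs].
  have im (y : A) : [set sval x | x in A] (sval (val y)).
    by exists (val y) => //; apply: set_valP.
  have [t ht] := cont_on_agr s cf (im x).
  apply/cyl_sub_nbhs; exists t => y a /=; apply: hs; rewrite !hF.
  by apply: ht.
move=> [f [g [[fV gU] cf cg gf fg]]].
have [F hF] := lift U V f fV; have [K hK] := lift V U g gU.
have im (A : set cyl_space) (y : A) : [set sval x | x in A] (sval (val y)).
  by exists (val y) => //; apply: set_valP.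
exists F, K; split.
- exact: cont cf hF.
- exact: cont cg hK.
- by move=> x; apply/val_inj/sval_inj; rewrite hK hF gf //; apply: im.
- by move=> x; apply/val_inj/sval_inj; rewrite hF hK fg //; apply: im.
Qed.

End CylinderSpace.

Theorem theorem5p2 (d : Order.disp_t) (W : orderType d) (hW : is_omega1 W)
    (hdiamond : diamond W) :
  exists X : topologicalType,
    [/\ infinite_set [set: X], fedorchuk_space X & h_homogeneous X].
Proof.
have [D _ D_guess] := hdiamond.
have [en [en_le en_surj]] := enum_below hW.
have [e e_inj] := code_exists hW.
have [H HG] := system_exists hW en_le en_surj (guess en e D) (taskof e D).
pose S := limit_set en H.
have cpt : compact [set: cyl_space S].
  by apply: cyl_compact => z0; apply: (limit_set_closed hW en_le en_surj HG).
exists (cyl_space S); split.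
- have /choice[b hb] n : exists x : cyl_space S, forall m, sval x (None, m)
    = (m == n).
    have [z Xz hz] := limit_set_base hW en_le H (fun i : option W * nat => i.2 == n).
    by exists (exist _ z Xz) => m; rewrite /= hz.
  move=> fin; apply: infinite_nat.
  have bI : injective b.
    by move=> m n E; apply/eqP; rewrite -hb -E hb.
  by have := finite_preimage (in2W bI) fin.
- split=> //.
  + exact: cyl_hausdorff.
  + move=> A; have [|E [cE EA Ed]] :=
      limit_set_hereditarily_separable hW en_le en_surj e_inj D_guess HG
        (A := [set sval x | x in A]).
      by move=> _ [x _ <-]; apply: (svalP x).
    exists [set x : A | E (sval (val x))].
      have /countable_injP[f fI] := cE; apply/countable_injP.
      exists (fun x : A => f (sval (val x))) => x y; rewrite !inE => Ex Ey /fI E'.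
      by apply/val_inj/sval_inj/E'; rewrite inE.
    move=> O [x Ox] oO.
    have /cyl_sub_nbhs[s hs] : nbhs x O by apply: open_nbhs_nbhs; split.
    have [|z Ez a] := Ed (sval (val x)) _ s.
      by exists (val x) => //; apply: set_valP.
    have [y Ay yz] := EA z Ez.
    exists (SigSub (mem_set Ay)); split=> /=; last by rewrite yz.
    by apply: hs; rewrite /= yz.
  + move=> u x ux; exists x.
    have [|||N hN] := limit_set_sequence hW en_le en_surj e_inj D_guess HG
        (u := fun n => sval (u n)) (x := sval x).
    * by move=> n; apply: (svalP (u n)).
    * exact: (svalP x).
    * move=> s; have /ux[N _ hN] : nbhs x [set y : cyl_space S | agr s (sval x)
        (sval y)].
        by apply/cyl_nbhs; exists s.
      by exists N => n /hN.
    by exists N => // n /= /hN /sval_inj.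
- split; first exact: cyl_clopen_base.
  move=> U V cU cV [u Uu] [v Vv].
  have [P [dP hP]] := cyl_clopen_det cpt cU; have [Q [dQ hQ]] :=
      cyl_clopen_det cpt cV.
  have imE (A : set (cyl_space S)) (R : (option W * nat -> bool) -> bool) :
      (forall x, A x <-> R (sval x)) ->
      [set sval x | x in A] = part en H R.
    move=> hR; apply/seteqP; split=> [_ [x Ax <-]|z [Xz Rz]].
      by split; [exact: (svalP x)|apply/hR].
    by exists (exist _ z Xz) => //; apply/hR.
  apply: cyl_homeomorphic; rewrite (imE U P) // (imE V Q) //.
  apply: (limit_set_homogeneous hW en_le en_surj e_inj D_guess HG) => //.
    by rewrite -(imE U P) //; exists (sval u), u.
  by rewrite -(imE V Q) //; exists (sval v), v.
Qed.
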